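(* Let $0<\alpha\le1$, $\gamma>0$, $\beta\ge\alpha\gamma$, $\theta>-\alpha\gamma$, and $\lambda\ge0$. Then for all $x\ge0$, $$x^{\beta+\theta-1}E^{\gamma+\theta/\alpha}_{\alpha,\beta+\theta}(-\lambda x^\alpha) = \frac{1}{\Gamma(\gamma+\theta/\alpha)}\int_0^\infty \{I_+^{\beta-\alpha\gamma} f_\alpha(\cdot\mid t)\}(x)\,t^{\gamma+\theta/\alpha-1}e^{-\lambda t}\,dt$$ $$= \frac{1}{\Gamma(\gamma+\theta/\alpha)}\int_0^\infty \{I_+^{\beta-\alpha\gamma} f_\alpha\}(x t^{-1/\alpha})\,t^{(\beta+\theta-1)/\alpha-1}e^{-\lambda t}\,dt .$$ In particular, if $\beta-\alpha\gamma=0$ this equals $\frac{1}{\Gamma(\gamma+\theta/\alpha)}\int_0^\infty f_\alpha(x t^{-1/\alpha})\,t^{(\beta+\theta-1)/\alpha-1}e^{-\lambda t}\,dt$, and if $\beta-\alpha\gamma=1-\alpha$ this equals $\frac{1}{\Gamma(\gamma+\theta/\alpha)}\,\frac{x}{\alpha}\int_0^\infty f_\alpha(x t^{-1/\alpha})\,t^{(\beta+\theta-2)/\alpha-1}e^{-\lambda t}\,dt$.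
   Context: The Prabhakar (three-parameter Mittag-Leffler) function is $E^\gamma_{\alpha,\beta}(z)=\frac{1}{\Gamma(\gamma)}\sum_{k=0}^\infty \frac{\Gamma(\gamma+k)}{k!\,\Gamma(\alpha k+\beta)}z^k$. For $0<\alpha<1$ and $t>0$, $f_\alpha(x\mid t)$ ($x\ge0$) denotes the density of the one-sided $\alpha$-stable distribution with scale $t$, defined by $\int_0^\infty e^{-sx} f_\alpha(x\mid t)\,dx = e^{-t s^\alpha}$; $f_\alpha(x):=f_\alpha(x\mid 1)$, and $f_\alpha(x\mid t)=f_\alpha(xt^{-1/\alpha})t^{-1/\alpha}$. For $\alpha=1$, $f_1(x\mid t):=\delta(x-t)$, with identities understood in the sense of measures. For $\nu>0$, $\{I_+^\nu f\}(x)=\frac{1}{\Gamma(\nu)}\int_0^x (x-u)^{\nu-1} f(u)\,du$ (Riemann–Liouville fractional integral, Laplace transform $s^{-\nu}\widetilde f(s)$), and $\{I_+^0 f\}:=f$.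
   Formalization: The identities are proved for x>0 rather than x≥0: at x=0 they fail when β+θ=1 (left side 1, right side 0), the left side is undefined when β+θ<1, and when β+θ>1 both sides are simply 0. *)

(* Defs.v *)
From HB Require Import structures.
From mathcomp Require Import all_boot all_order all_algebra.
From mathcomp Require Import all_classical all_reals all_analysis.
Set Implicit Arguments. Unset Strict Implicit. Unset Printing Implicit Defensive.
Import Order.TTheory GRing.Theory Num.Theory.
Import numFieldNormedType.Exports.
Local Open Scope classical_set_scope.
Local Open Scope ring_scope.

Section Defs.
Variable R : realType.
Local Notation mu := (@lebesgue_measure R).

Definition Gamma (s : R) : R :=
  fine (\int[mu]_(t in `]0%R, +oo[) ((t `^ (s - 1)) * expR (- t))%:E)%E.

Definition prabhakar (g a b z : R) : R :=
  limn (fun n => \sum_(k < n)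
     ((Gamma g)^-1 * (Gamma (g + k%:R) / ((k`!)%:R * Gamma (a * k%:R + b))) * z ^+ k)).

(* f : R -> R is the density (on x >= 0) of the one-sided alpha-stable law with
   scale 1: nonnegative, measurable, continuous on (0,oo), with Laplace transform
   int_0^oo e^(-s x) f(x) dx = e^(-s^alpha) for all s >= 0.  (0 < alpha < 1) *)
Definition stable_density (alpha : R) (f : R -> R) : Prop :=
  [/\ measurable_fun [set: R] f,
      (forall x, 0 <= x -> 0 <= f x),
      (forall x, 0 < x -> {for x, continuous f}) &
      (forall s, 0 <= s ->
         (\int[mu]_(x in `[0%R, +oo[) (expR (- (s * x)) * f x)%:E)%E
         = (expR (- (s `^ alpha)))%:E)].

Definition stable_scaled (alpha : R) (f : R -> R) (t : R) : R -> R :=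
  fun x => f (x * t `^ (- alpha^-1)) * t `^ (- alpha^-1).

Definition RL_int (nu : R) (f : R -> R) (x : R) : \bar R :=
  if nu == 0 then (f x)%:E
  else (((Gamma nu)^-1)%:E * \int[mu]_(u in `[0%R, x]) ((x - u) `^ (nu - 1) * f u)%:E)%E.

(* ---- measure-sense versions (used for alpha = 1, where f_1(.|t) = dirac t) ---- *)

Definition RL_meas (nu : R) (rho : {measure set (measurableTypeR R) -> \bar R}) (A : set R) : \bar R :=
  if nu == 0 then rho A
  else (\int[mu]_(x in A)
          (((Gamma nu)^-1)%:E * \int[rho]_(u in `[0%R, x]) ((x - u) `^ (nu - 1))%:E))%E.

(* For a measure rho and s > 0, the measure "x |-> rho(s x)" (composition of rho with
   the dilation x |-> s x): A |-> s^-1 rho(s A).  When rho has density r this is the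
   measure with density x |-> r(s x). *)
Definition dilate (rho : set R -> \bar R) (s : R) (A : set R) : \bar R :=
  ((s^-1)%:E * rho [set y : R | A (y / s)%R])%E.

(* The measure "x |-> x * rho(s x)": A |-> s^-1 int_{sA} (y/s) rho(dy).
   When rho has density r this is the measure with density x |-> x r(s x). *)
Definition dilate_x (rho : {measure set (measurableTypeR R) -> \bar R}) (s : R) (A : set R) : \bar R :=
  ((s^-1)%:E * \int[rho]_(y in [set y : R | A (y / s)%R]) (y / s)%R%:E)%E.

End Defs.

(* Main.v *)
(** Everything reduces to moments. Since [u^-(1+s)] is a Gamma integral of
    exponentials, Tonelli and the (differentiated) Laplace transform of the stable
    density give [int u^-s f(u) du = Gamma(1 + s/alpha) / Gamma(1 + s)] for
    [s > -alpha]; differentiating is what makes the range [-alpha < s <= 0], needed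
    for the case [beta - alpha gamma = 1 - alpha], accessible. A power substitution
    and the beta integral then give, for [G(t)] the [t]-integrand without the factor
    [e^(-lambda t)], moments [int G(t) t^k dt] which are exactly the Prabhakar
    coefficients. Expanding [e^(-lambda t)] is justified by dominated convergence,
    because the Prabhakar series converges at [+lambda x^alpha]. For [alpha = 1] the
    same argument applies with [G(t) = (x - t)^(nu - 1) t^(delta - 1)] on [(0, x)],
    followed by Tonelli. *)
Require Import Defs.
From HB Require Import structures.
From mathcomp Require Import all_boot all_order all_algebra.
From mathcomp Require Import all_classical all_reals all_analysis.
From mathcomp Require Import measurable_realfun.
From mathcomp Require Import ring lra.
Import Order.TTheory GRing.Theory Num.Theory.
Import numFieldNormedType.Exports.
Local Open Scope classical_set_scope.
Local Open Scope ring_scope.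

(** * Change of variables *)

(** The data enter only through [nu] = beta - alpha gamma, [delta] = gamma + theta / alpha, alpha
    and lambda, because beta + theta = nu + alpha delta; the hypotheses on beta and theta say
    exactly that nu >= 0 and delta > 0. The kernels are measurable and nonnegative in t, but a
    fractional integral may be infinite at some t. Substitutions and exchanges are therefore proved
    for nonnegative measurable extended-real functions, from the uniqueness of Lebesgue measure and
    Tonelli, and finiteness is read off from the value of the moments. The last identity uses the
    moments of its own kernel: for nu = 1 - alpha the k-th one is the stable moment with s = alpha
    (delta + k - 1), which is negative when k = 0 and delta < 1. *)

Section density.
Import HBNNSimple.

(** The hypothesis on sets is the case of indicators; linearity gives simple functions and monotone
    convergence the rest. It serves for the measure with density exp in the exponential
    substitution. *)
Lemma ge0_integral_density d (T : measurableType d) (R : realType)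
    (mu nu : {measure set T -> \bar R}) (w : T -> R) (G : T -> \bar R) :
  measurable_fun [set: T] w -> (forall x, 0 <= w x) ->
  (forall A, measurable A -> nu A = \int[mu]_(x in A) (w x)%:E)%E ->
  measurable_fun [set: T] G -> (forall x, 0 <= G x)%E ->
  (\int[nu]_x G x = \int[mu]_x (G x * (w x)%:E))%E.
Proof.
move=> mw w0 nuE mG G0.
pose h := nnsfun_approx measurableT mG.
have hG x : (EFin \o h ^~ x) n @[n --> \oo] --> G x.
  by apply: cvg_nnsfun_approx => // y _; exact: G0.
have wE0 x : (0 <= (w x)%:E)%E by rewrite lee_fin.
have mh n : measurable_fun [set: T] (EFin \o h n) by exact/measurable_EFinP.
have mwE : measurable_fun [set: T] (EFin \o w) by exact/measurable_EFinP.
have ndh x a b : (a <= b)%N -> (h a x <= h b x)%R.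
  by move=> ab; have /lefP := nd_nnsfun_approx measurableT mG ab; exact.
have suf n : (\int[nu]_x (h n x)%:E = \int[mu]_x ((h n x)%:E * (w x)%:E))%E.
  rewrite integralT_nnsfun sintegralE.
  transitivity (\int[mu]_x (\sum_(y \in range (h n))
      (y * \1_(h n @^-1` [set y]) x)%:E * (w x)%:E))%E; last first.
    apply: eq_integral => x _; rewrite -ge0_mule_fsuml; last first.
      by move=> y; exact: nnfun_muleindic_ge0.
    by rewrite fsumEFin// -fimfunE.
  rewrite ge0_integral_fsum//; last 2 first.
  - move=> y; apply: emeasurable_funM => //.
    by apply/measurable_EFinP; apply: measurable_funM => //.
  - by move=> y x _; rewrite mule_ge0// nnfun_muleindic_ge0.
  apply: eq_fsbigr => r; rewrite inE => -[t _ <-].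
  under eq_integral do rewrite EFinM -muleA.
  rewrite ge0_integralZl//.
  - congr (_ * _)%E; rewrite nuE//; rewrite integral_mkcond epatch_indic.
    by apply: eq_integral => x _; rewrite muleC.
  - by apply: emeasurable_funM => //; apply/measurable_EFinP.
  - by move=> x _; rewrite mule_ge0// lee_fin.
  - by rewrite lee_fin.
transitivity (limn (fun n => \int[nu]_x (EFin \o h n) x)%E).
  rewrite -monotone_convergence//.
  - by apply: eq_integral => x _; apply/esym/cvg_lim => //; exact: hG.
  - by move=> n x _ /=; rewrite lee_fin.
  - by move=> x _ a b ab; rewrite lee_fin ndh.
under eq_fun do rewrite suf.
rewrite -monotone_convergence//.
- apply: eq_integral => x _; apply/cvg_lim => //.
  by apply: (cvgeZr _ (hG x)).
- by move=> n; exact: (emeasurable_funM (mh n) mwE).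
- by move=> n x _ /=; rewrite mule_ge0 ?lee_fin.
- by move=> x _ a b ab; rewrite lee_wpmul2r// lee_fin ndh.
Qed.

End density.

Section linear_change.
Context {R : realType}.
Local Notation mu := (@lebesgue_measure R).
Implicit Types (G : R -> \bar R) (c k : R).

(** The image of Lebesgue measure under a translation gives every half-open interval its length, so
    it is Lebesgue measure by uniqueness. No regularity of [G] beyond measurability enters. *)
Lemma ge0_integral_addr G c :
  measurable_fun [set: R] G -> (forall x, 0 <= G x)%E ->
  (\int[mu]_x G (x + c)%R = \int[mu]_x G x)%E.
Proof.
move=> mG G0.
pose phi : measurableTypeR R -> measurableTypeR R := fun x => (x + c)%R.
have mphi : measurable_fun setT phi by exact: measurable_funD.
pose nu : {measure set (measurableTypeR R) -> \bar R} :=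
  measure_function_pushforward__canonical__measure_function_Measure mu mphi.
have -> : (\int[mu]_x G (x + c)%R = \int[nu]_x G x)%E.
  by rewrite (ge0_integral_pushforward mphi).
apply: eq_measure_integral => A mA _ /=.
apply/esym/(@lebesgue_measure_unique _ nu) => // _ [[a b]] _ <- /=.
rewrite /nu /= /pushforward [X in _ = mu X](_ : _ = `]a - c, b - c]%classic); last first.
  by apply/seteqP; split => x /=; rewrite /phi !in_itv/= ltrBlDr lerBrDr.
rewrite !lebesgue_measure_itv/= !lte_fin ltrD2r; case: ifP => // _.
by rewrite !EFinB; congr EFin; ring.
Qed.

Lemma ge0_integral_mulr G k : k != 0 ->
  measurable_fun [set: R] G -> (forall x, 0 <= G x)%E ->
  (\int[mu]_x (`|k|%:E * G (k * x)%R) = \int[mu]_x G x)%E.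
Proof.
move=> k0 mG G0.
pose phi : measurableTypeR R -> measurableTypeR R := fun x => (k * x)%R.
have mphi : measurable_fun setT phi by exact: measurable_funM.
pose nu : {measure set (measurableTypeR R) -> \bar R} :=
  measure_function_pushforward__canonical__measure_function_Measure mu mphi.
pose ak : {nonneg R} := NngNum (normr_ge0 k).
rewrite ge0_integralZl//; last exact: measurableT_comp.
transitivity (\int[mscale ak nu]_x G x)%E.
  by rewrite ge0_integral_mscale// (ge0_integral_pushforward mphi).
apply: eq_measure_integral => A mA _ /=.
apply/esym/(@lebesgue_measure_unique _ (mscale ak nu)) => //.
move=> _ [[a b]] _ <- /=.
rewrite /mscale /nu /= /pushforward.
have [k_gt0|k_lt0|k0'] := ltgtP 0 k; last by rewrite -k0' eqxx in k0.
- rewrite [X in _ = (_ * mu X)%E](_ : _ = `]a / k, b / k]%classic); last first.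
    by apply/seteqP; split => x /=; rewrite /phi !in_itv/= ltr_pdivrMr// ler_pdivlMr// [x * k]mulrC.
  rewrite !lebesgue_measure_itv/= !lte_fin ltr_pM2r ?invr_gt0//; case: ifP => // _; last first.
    by rewrite mule0.
  by rewrite gtr0_norm//= -!EFinB -EFinM; congr EFin; field; rewrite gt_eqF.
(* For negative [k] the preimage is closed on the left and open on the right, with the same
   length. *)
- rewrite [X in _ = (_ * mu X)%E](_ : _ = `[b / k, a / k[%classic); last first.
    by apply/seteqP; split => x /=; rewrite /phi !in_itv/= ltr_ndivlMr// ler_ndivrMr// [x * k]mulrC andbC.
  rewrite !lebesgue_measure_itv/= !lte_fin ltr_nM2r ?invr_lt0//; case: ifP => // _; last first.
    by rewrite mule0.
  by rewrite ltr0_norm//= -!EFinB -EFinM; congr EFin; field; rewrite lt_eqF.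
Qed.

Lemma integral_expR_Ny c :
  (\int[mu]_(x in `]-oo, c]) (expR x)%:E = (expR c)%:E)%E.
Proof.
rewrite -[in LHS](opprK c) ge0_integration_by_substitutionNy; last 2 first.
- by apply: continuous_subspaceT => x; exact: continuous_expR.
- by move=> x _; exact: expR_ge0.
have dN (x : R) : is_derive x 1 (fun y : R => - expR (- y)) (expR (- x)).
  by apply: is_derive_eq; rewrite mulrN1 opprK.
have c0 : continuous (fun y : R => expR (- y)).
  by move=> x; apply: continuous_comp; [exact: opp_continuous|exact: continuous_expR].
rewrite (@ge0_continuous_FTC2y _ _ (fun y => - expR (- y)) _ 0)/= ?add0e ?opprK//.
- exact: continuous_subspaceT.
- by rewrite -oppr0; apply: cvgN; exact: cvgr_expR.
- by apply: cvgN; apply: cvg_at_right_filter; have := c0 (- c); rewrite /continuous_at opprK.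
- by move=> x _; rewrite derive1E; exact: derive_val.
Qed.

End linear_change.

Section multiplicative_change.
Context {R : realType}.
Local Notation mu := (@lebesgue_measure R).
Local Notation P := (`]0%R, +oo[%classic : set R).
Implicit Types (G : R -> \bar R) (c p : R).

Lemma measurable_comp_pos G (h : R -> R) :
  measurable_fun P G -> measurable_fun P h -> (forall x, 0 < x -> 0 < h x) ->
  measurable_fun P (fun x => G (h x)).
Proof.
move=> mG mh h0; apply/(@measurable_comp _ _ _ _ _ _ P) => //.
by move=> _ [x + <-]; rewrite /= !in_itv/= !andbT; exact: h0.
Qed.

Lemma measurable_comp_expR G : measurable_fun P G ->
  measurable_fun [set: R] (fun x => G (expR x)).
Proof.
move=> mG; apply/(@measurable_comp _ _ _ _ _ _ P) => //.
by move=> _ [x _ <-]; rewrite /= in_itv/= andbT expR_gt0.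
Qed.

(* Through [x = expR v] the multiplicative substitutions below become the affine ones above. *)
Lemma ge0_integral_exp G : measurable_fun P G -> (forall x : R, 0 < x -> (0 <= G x)%E) ->
  (\int[mu]_(x in P) G x = \int[mu]_v (G (expR v) * (expR v)%:E))%E.
Proof.
have m0 : measurable (`]-oo, 0%R]%classic : set R) by exact: measurable_itv.
have mexpE : measurable_fun [set: R] (fun x : R => (expR x)%:E).
  by apply/measurable_EFinP; exact: measurable_expR.
pose m1f (B : set (measurableTypeR R)) := (\int[mu]_(x in B) (expR x)%:E)%E.
have m1f0 : (m1f set0 = 0)%E by rewrite /m1f integral_set0.
have m1f_ge0 B : (0 <= m1f B)%E by apply: integral_ge0 => x _; rewrite lee_fin expR_ge0.
have m1f_sigma : semi_sigma_additive m1f.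
  by apply: semi_sigma_additive_nng_induced => // x; rewrite lee_fin expR_ge0.
pose m1 : {measure set (measurableTypeR R) -> \bar R} :=
  HB.pack m1f (isMeasure.Build _ _ _ m1f m1f0 m1f_ge0 m1f_sigma).
pose phi : measurableTypeR R -> measurableTypeR R := expR.
have mphi : measurable_fun setT phi by exact: measurable_expR.
pose m2 : {measure set (measurableTypeR R) -> \bar R} :=
  measure_function_pushforward__canonical__measure_function_Measure m1 mphi.
pose m3 : {measure set (measurableTypeR R) -> \bar R} := mrestr mu m0.
(* The image under exp of the measure with density exp lives on the positive half-line only. Adding
   the restriction of Lebesgue measure to the other half-line gives a measure on the whole line, to
   which uniqueness applies. *)
have muE A : measurable A ->
    (mu A = m1f (expR @^-1` A) + mu (A `&` `]-oo, 0%R]))%E.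
  move=> mA.
  suff -> : (mu A = measure_add m2 m3 A)%E by rewrite measure_addE.
  apply: (@lebesgue_measure_unique _ (measure_add m2 m3)) => // {A mA} _ [[a b]] _ <-.
  transitivity (m1f (expR @^-1` `]a, b]) + mu (`]a, b] `&` `]-oo, 0%R]))%E; last first.
    exact/esym/(measure_addE m2 m3).
  rewrite /m1f /=.
  have -> : (mu `]a, b] = mu (`]a, b] `&` `]0%R, +oo[) + mu (`]a, b] `&` `]-oo, 0%R]))%E.
    rewrite -measureU//; last 3 first.
    - exact: measurableI.
    - exact: measurableI.
    - apply/seteqP; split => x //=; rewrite !in_itv/= => -[[_ +] [_]].
      by rewrite andbT; case: ltgtP.
    congr (mu _); apply/seteqP; split => x /=; rewrite !in_itv/= andbT.
      by case: (ltP 0 x) => // ? ?; [left|right].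
    by case=> -[].
  congr (_ + _)%E.
  (* The preimage of []a, b]] under exp is empty, a left half-line or a bounded interval, according
     to the position of 0 with respect to [a] and [b]. *)
  have [b0|b0] := leP b 0.
    rewrite [X in mu X](_ : _ = set0); last first.
      by apply/seteqP; split => x //=; rewrite !in_itv/= andbT => -[/andP[_ xb]]; rewrite ltNge (le_trans xb).
    rewrite measure0 [X in integral _ X _](_ : _ = set0) ?integral_set0//.
    apply/seteqP; split => x //=; rewrite !in_itv/= => /andP[_ xb].
    by have := expR_gt0 x; rewrite ltNge (le_trans xb).
  have expb : expR @^-1` `]-oo, b]%classic = `]-oo, ln b]%classic.
    apply/seteqP; split => x /=; rewrite !in_itv/=.
      by rewrite -[in X in X -> _](lnK b0) ler_expR.
    by rewrite -[in X in _ -> X](lnK b0) ler_expR.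
  have [a0|a0] := leP a 0.
    rewrite [X in mu X](_ : _ = `]0, b]%classic); last first.
      apply/seteqP; split => x /=; rewrite !in_itv/= andbT; first by case=> /andP[_ ->] ->.
      by move=> /andP[x0 ->]; rewrite x0 (le_lt_trans a0).
    rewrite [X in integral _ X _](_ : _ = expR @^-1` `]-oo, b]%classic); last first.
      apply/seteqP; split => x /=; rewrite !in_itv/=; first by case/andP.
      by move=> ->; rewrite (le_lt_trans a0)// expR_gt0.
    rewrite expb integral_expR_Ny lnK// lebesgue_measure_itv/= lte_fin b0.
    by rewrite sube0.
  rewrite [X in mu X](_ : _ = `]a, b]%classic); last first.
    apply/seteqP; split => x /=; rewrite !in_itv/= andbT; first by case=> /andP[-> ->].
    by move=> /andP[ax ->]; rewrite ax (lt_trans a0).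
  rewrite lebesgue_measure_itv/= lte_fin.
  have [ab|ba] := ltP a b; last first.
    rewrite [X in integral _ X _](_ : _ = set0) ?integral_set0//.
    apply/seteqP; split => x //=; rewrite !in_itv/= => /andP[ax xb].
    by have := lt_le_trans ax (le_trans xb ba); rewrite ltxx.
  rewrite [X in integral _ X _](_ : _ = `]ln a, ln b]%classic); last first.
    apply/seteqP; split => x /=; rewrite !in_itv/=.
      by rewrite -[in X in X -> _](lnK b0) -[in X in X -> _](lnK a0) ler_expR ltr_expR.
    by rewrite -[in X in _ -> X](lnK b0) -[in X in _ -> X](lnK a0) ler_expR ltr_expR.
  have lnab : ln a < ln b by rewrite ltr_ln.
  rewrite integral_itv_obnd_cbnd; last exact: measurable_funTS.
  rewrite (@continuous_FTC2 _ _ expR)//.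
  - by rewrite !lnK// -EFinB.
  - by apply: continuous_subspaceT => x; exact: continuous_expR.
  - split => [x _||].
    + exact: derivable_expR.
    + by apply: cvg_at_right_filter; exact: continuous_expR.
    + by apply: cvg_at_left_filter; exact: continuous_expR.
  - by move=> x _; rewrite derive1E derive_val.
move=> mG G0.
have mP : measurable P by exact: measurable_itv.
transitivity (\int[m2]_(x in P) G x)%E.
  apply: eq_measure_integral => A mA AP.
  rewrite /= [LHS](muE A mA) (_ : A `&` _ = set0) ?measure0 ?adde0//.
  apply/seteqP; split => x //= -[/AP/=]; rewrite !in_itv/= andbT => x0.
  by rewrite leNgt x0.
rewrite (ge0_integral_pushforward mphi)//; last first.
  by move=> x; rewrite inE/= in_itv/= andbT; exact: G0.
have -> : phi @^-1` P = setT.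
  by apply/seteqP; split => x // _; rewrite /phi/= in_itv/= andbT expR_gt0.
rewrite (@ge0_integral_density _ _ _ mu m1 (@expR R))//.
- exact: measurable_comp_expR.
- by move=> x; apply: G0; exact: expR_gt0.
Qed.

Lemma ge0_integral_scale G c : 0 < c ->
  measurable_fun P G -> (forall x : R, 0 < x -> (0 <= G x)%E) ->
  (\int[mu]_(x in P) (G (c * x)%R * c%:E) = \int[mu]_(x in P) G x)%E.
Proof.
move=> c0 mG G0.
pose H v := (G (expR v) * (expR v)%:E)%E.
have mH : measurable_fun setT H.
  apply: emeasurable_funM; first exact: measurable_comp_expR.
  by apply/measurable_EFinP; exact: measurable_expR.
have H0 v : (0 <= H v)%E by rewrite mule_ge0 ?G0 ?lee_fin ?expR_gt0// ?expR_ge0.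
rewrite !ge0_integral_exp//.
- rewrite -[RHS](ge0_integral_addr _ (ln c) mH)//; apply: eq_integral => v _.
  by rewrite /H expRD lnK// [c * _]mulrC -muleA -EFinM [_ * c]mulrC.
- apply: emeasurable_funM => //; apply: measurable_comp_pos => //.
  by move=> x; exact: mulr_gt0.
- by move=> x x0; rewrite mule_ge0 ?lee_fin ?(ltW c0)// G0// mulr_gt0.
Qed.

Lemma ge0_integral_powR G p : p != 0 ->
  measurable_fun P G -> (forall x : R, 0 < x -> (0 <= G x)%E) ->
  (\int[mu]_(x in P) (G (x `^ p)%R * (`|p| * x `^ (p - 1))%:E) =
   \int[mu]_(x in P) G x)%E.
Proof.
move=> p0 mG G0.
pose H v := (G (expR v) * (expR v)%:E)%E.
have mH : measurable_fun setT H.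
  apply: emeasurable_funM; first exact: measurable_comp_expR.
  by apply/measurable_EFinP; exact: measurable_expR.
have H0 v : (0 <= H v)%E by rewrite mule_ge0 ?G0 ?lee_fin ?expR_gt0// ?expR_ge0.
rewrite !ge0_integral_exp//.
- rewrite -[RHS](ge0_integral_mulr _ p p0 mH)//; apply: eq_integral => v _.
  rewrite /H -expRM [v * p]mulrC -muleA [RHS]muleCA -!EFinM; congr (_ * _%:E)%E.
  rewrite -mulrA; congr (_ * _).
  by rewrite -expRM -expRD; congr expR; ring.
- apply: emeasurable_funM.
    apply: measurable_comp_pos => //; first exact: measurable_funTS.
    by move=> x x0; exact: powR_gt0.
  by apply/measurable_EFinP/measurable_funTS; exact: measurable_funM.
- by move=> x x0; rewrite mule_ge0 ?lee_fin ?mulr_ge0 ?powR_ge0// G0// powR_gt0.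
Qed.

End multiplicative_change.

(** * Measurability of elementary expressions *)

Section measurability.
Context {d} {T : measurableType d} {R : realType}.
Implicit Types (D : set T) (h : T -> R).

Lemma measurable_fun_powR D h p :
  measurable_fun D h -> measurable_fun D (fun x => h x `^ p).
Proof. exact: (measurableT_comp (measurable_powR p)). Qed.

Lemma measurable_fun_expR D h :
  measurable_fun D h -> measurable_fun D (fun x => expR (h x)).
Proof. exact: (measurableT_comp (@measurable_expR R)). Qed.

Lemma measurable_fun_opp D h :
  measurable_fun D h -> measurable_fun D (fun x => - h x).
Proof. exact: (measurableT_comp (@oppr_measurable R setT)). Qed.

Lemma measurable_fun_indic D h (B : set R) : measurable B ->
  measurable_fun D h -> measurable_fun D (fun x => \1_B (h x) : R).
Proof. by move=> mB mh; apply: (measurableT_comp _ mh); exact: measurable_indic. Qed.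

Lemma measurable_fun_EFin D h :
  measurable_fun D h -> measurable_fun D (fun x => (h x)%:E).
Proof. by move=> mh; exact/measurable_EFinP. Qed.

Lemma measurable_fun_cstr D (r : R) : measurable_fun D (fun=> r).
Proof. exact: measurable_cst. Qed.

End measurability.

Ltac mfun := repeat first
  [ assumption
  | solve [exact: measurable_fun_cstr]
  | solve [exact: measurable_id]
  | solve [exact: measurable_fst]
  | solve [exact: measurable_snd]
  | solve [exact: measurable_itv]
  | apply: measurable_fun_EFin
  | apply: measurable_fun_powR
  | apply: measurable_fun_expR
  | apply: measurable_fun_indic
  | apply: measurable_fun_opp
  | apply: measurable_funM
  | apply: measurable_funB
  | apply: measurable_funD ].

(** * Tonelli and rescaling on subsets of the line *)

Section integration_tools.
Context {R : realType}.
Local Notation mu := (@lebesgue_measure R).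
Local Notation P := (`]0%R, +oo[%classic : set R).

Lemma in_pos (x : R) : P x = (0 < x) :> Prop.
Proof. by rewrite /= in_itv/= andbT. Qed.

Lemma measurable_pos : measurable P.
Proof. exact: measurable_itv. Qed.

(** Substitutions and Tonelli are applied on a fixed domain; this moves a variable or smaller domain
    into the integrand and back. *)
Lemma integral_indicM (A B : set R) (h : R -> R) :
  (\int[mu]_(x in A) (\1_B x * h x)%:E = \int[mu]_(x in A `&` B) (h x)%:E)%E.
Proof.
rewrite integral_mkcondr; apply: eq_integral => x _.
by rewrite /patch indicE; case: ifPn => _; rewrite ?mul1r ?mul0r.
Qed.

Section tonelli.
Variables (A B : set R) (K : R -> R -> \bar R).
Hypotheses (mA : measurable A) (mB : measurable B).
Hypothesis mK : measurable_fun [set: R * R] (fun z => K z.1 z.2).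
Hypothesis K0 : forall x y, A x -> B y -> (0 <= K x y)%E.

Let KAB := (fun z => K z.1 z.2) \_ (A `*` B).

Let mKAB : measurable_fun [set: R * R] KAB.
Proof.
apply/(measurable_restrictT _ _).1; first exact: measurableX.
exact: measurable_funTS.
Qed.

Let KAB0 z : (0 <= KAB z)%E.
Proof. by rewrite /KAB /patch; case: ifPn => //; rewrite inE => -[]; exact: K0. Qed.

Let KAB_x x : A x -> (\int[mu]_y KAB (x, y) = \int[mu]_(y in B) K x y)%E.
Proof.
move=> Ax; rewrite [RHS]integral_mkcond; apply: eq_integral => y _.
rewrite /KAB /patch/=; have [yB|yB] := boolP (y \in B).
  by rewrite mem_set//; split => //=; rewrite inE in yB.
by rewrite memNset// => -[_ /mem_set]; exact/negP.
Qed.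

Let KAB_y y : B y -> (\int[mu]_x KAB (x, y) = \int[mu]_(x in A) K x y)%E.
Proof.
move=> By; rewrite [RHS]integral_mkcond; apply: eq_integral => x _.
rewrite /KAB /patch/=; have [xA|xA] := boolP (x \in A).
  by rewrite mem_set//; split => //=; rewrite inE in xA.
by rewrite memNset// => -[/mem_set]; move/negP: xA.
Qed.

Lemma tonelli_on :
  (\int[mu]_(x in A) \int[mu]_(y in B) K x y =
   \int[mu]_(y in B) \int[mu]_(x in A) K x y)%E.
Proof.
transitivity (\int[mu]_x \int[mu]_y KAB (x, y))%E.
  rewrite integral_mkcond; apply: eq_integral => x _; rewrite /patch.
  have [xA|xA] := boolP (x \in A); first by rewrite KAB_x// -inE.
  rewrite integral0_eq// => y _; rewrite /KAB/= /patch memNset// => -[/mem_set].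
  by move/negP: xA.
rewrite [LHS](fubini_tonelli (m1 := mu) (m2 := mu) KAB mKAB KAB0) [RHS]integral_mkcond.
apply: eq_integral => y _; rewrite /patch.
have [yB|yB] := boolP (y \in B); first by rewrite KAB_y// -inE.
rewrite integral0_eq// => x _; rewrite /KAB/= /patch memNset// => -[_ /mem_set].
by move/negP: yB.
Qed.

Lemma measurable_integral_on :
  measurable_fun A (fun x => \int[mu]_(y in B) K x y)%E.
Proof.
have := measurable_fun_fubini_tonelli_F (m2 := mu) KAB mKAB KAB0.
move=> /(measurable_funS measurableT (@subsetT _ A)).
by apply: eq_measurable_fun => x; rewrite inE => Ax; rewrite /fubini_F KAB_x.
Qed.

End tonelli.

Lemma ge0_integral_scale_itv (h : R -> R) (r c : R) : 0 < c ->
  measurable_fun [set: R] h -> (forall x, 0 < x < r -> 0 <= h x) ->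
  (\int[mu]_(x in `]0%R, r[) (h x)%:E =
   \int[mu]_(x in `]0%R, (r / c)%R[) (h (c * x) * c)%:E)%E.
Proof.
move=> c0 mh h0; pose G x := (\1_(`]0, r[%classic : set R) x * h x)%:E.
have PI s : (`]0, s[%classic : set R) = P `&` `]0, s[%classic.
  by apply/seteqP; split => x /=; rewrite !in_itv/= andbT; [move=> /andP[-> ->]|case].
rewrite (PI r) (PI (r / c)) -(integral_indicM P _ h) -(integral_indicM P _ (fun x => h (c * x) * c)).
rewrite -[LHS](ge0_integral_scale G c c0)//.
- apply: eq_integral => x; rewrite inE in_pos => x0; rewrite /G -EFinM; congr EFin.
  rewrite !indicE mulrA; congr ((nat_of_bool _)%:R * _ * _).
  by apply/idP/idP; rewrite !inE/= !in_itv/= x0 mulr_gt0//= ltr_pdivlMr// mulrC.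
- by apply: measurable_funTS; rewrite /G; mfun.
- move=> x x0; rewrite lee_fin indicE.
  have [|_] := boolP (x \in (`]0, r[%classic : set R)); last by rewrite mul0r.
  by rewrite inE/= in_itv/= => xr; rewrite mul1r h0.
Qed.

End integration_tools.

(** * Gamma and beta integrals *)

Section gamma.
Context {R : realType}.
Local Notation mu := (@lebesgue_measure R).
Local Notation P := (`]0%R, +oo[%classic : set R).
Implicit Types (a b r t u x : R).

(** [Gamma] takes [fine], which would turn an infinite integral into 0. Identities are first proved
    for this extended-real integral, and finiteness is deduced from them. *)
Let gint a := (\int[mu]_(t in P) (t `^ (a - 1) * expR (- t))%:E)%E.

Let beta a b := (\int[mu]_(u in `]0%R, 1%R[) (u `^ (a - 1) * (1 - u) `^ (b - 1))%:E)%E.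

Lemma gt0_powRD x t u : 0 < x -> x `^ (t + u) = x `^ t * x `^ u.
Proof. by move=> x0; rewrite powRD// (gt_eqF x0) implybT. Qed.

Lemma powR1l x : 1 `^ x = 1 :> R.
Proof. by rewrite powR1. Qed.

Lemma itv0E r : (`]0, r[%classic : set R) = P `&` `]0, r[%classic.
Proof.
by apply/seteqP; split => x /=; rewrite !in_itv/= andbT; [move=> /andP[-> ->]|case].
Qed.

Let gint_ge0 a : (0 <= gint a)%E.
Proof. by apply: integral_ge0 => t _; rewrite lee_fin mulr_ge0 ?powR_ge0 ?expR_ge0. Qed.

Let beta_ge0 a b : (0 <= beta a b)%E.
Proof. by apply: integral_ge0 => t _; rewrite lee_fin mulr_ge0 ?powR_ge0. Qed.

Let beta_scale a b r : 0 < r ->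
  (\int[mu]_(u in `]0%R, r[) (u `^ (a - 1) * (r - u) `^ (b - 1))%:E =
   (r `^ (a + b - 1))%:E * beta a b)%E.
Proof.
move=> r0; rewrite (ge0_integral_scale_itv _ r r)//; last 2 first.
- by mfun.
- by move=> x _; rewrite mulr_ge0 ?powR_ge0.
rewrite divff ?gt_eqF// /beta -ge0_integralZl//; last 3 first.
- by mfun.
- by move=> x _; rewrite lee_fin mulr_ge0 ?powR_ge0.
- by rewrite lee_fin powR_ge0.
apply: eq_integral => x; rewrite inE/= in_itv/= => /andP[x0 x1].
rewrite -EFinM; congr EFin; rewrite -[X in (X - r * x)]mulr1 -mulrBr.
rewrite !powRM ?(ltW x0) ?(ltW r0) ?subr_ge0 ?(ltW x1)//.
have -> : r `^ (a + b - 1) = r `^ (a - 1) * r `^ (b - 1) * r.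
  by rewrite -{4}(powRr1 (ltW r0)) -!gt0_powRD//; congr (_ `^ _); ring.
by ring.
Qed.

(** Substituting r = p + q leaves the condition r > p, kept as an indicator so that r still ranges
    over the whole positive half-line. *)
Let gint_shift b p : 0 < p ->
  gint b = (\int[mu]_(r in P) (\1_P (r - p) * ((r - p) `^ (b - 1) * expR (- (r - p))))%:E)%E.
Proof.
move=> p0; pose G q := (\1_P q * (q `^ (b - 1) * expR (- q)) : R)%:E.
have mG : measurable_fun [set: R] G by rewrite /G; mfun.
have G0 q : (0 <= G q)%E.
  by rewrite lee_fin !mulr_ge0 ?powR_ge0 ?expR_ge0// indicE.
transitivity (\int[mu]_q G q)%E.
  by rewrite (integral_indicM setT P (fun q => q `^ (b - 1) * expR (- q))) setTI.
rewrite -(ge0_integral_addr G (- p)%R mG G0) [RHS]integral_mkcond.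
apply: eq_integral => r _; rewrite /patch; case: ifPn => // rP.
rewrite /G indicE memNset ?mul0r// => /=; rewrite in_itv/= andbT subr_gt0 => pr.
by move/negP: rP; apply; rewrite inE in_pos (lt_trans p0).
Qed.

(** Put r = p + q in the double integral, exchange, and integrate over p in (0, r) first: by
    homogeneity this gives r^(a+b-1) times the beta integral. All terms are nonnegative, so no
    positivity of [a] or [b] is required, and the formula may be used before finiteness is known. *)
Let gint_beta a b : (gint a * gint b = gint (a + b) * beta a b)%E.
Proof.
pose K p r : \bar R := (\1_P (r - p) * (p `^ (a - 1) * (r - p) `^ (b - 1) * expR (- r)))%:E.
have K0 p r : (0 <= K p r)%E.
  by rewrite lee_fin !mulr_ge0 ?powR_ge0 ?expR_ge0// indicE.
transitivity (\int[mu]_(p in P) \int[mu]_(r in P) K p r)%E.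
  rewrite /gint -ge0_integralZr//; last 3 first.
  - by apply: measurable_funTS; mfun.
  - by move=> x _; rewrite lee_fin mulr_ge0 ?powR_ge0 ?expR_ge0.
  - exact: gint_ge0.
  apply: eq_integral => p; rewrite inE in_pos => p0.
  rewrite -/(gint b) (gint_shift b p p0) -ge0_integralZl//; last 3 first.
  - by apply: measurable_funTS; mfun.
  - by move=> x _; rewrite lee_fin !mulr_ge0 ?powR_ge0 ?expR_ge0// indicE.
  - by rewrite lee_fin mulr_ge0 ?powR_ge0 ?expR_ge0.
  apply: eq_integral => r _; rewrite /K -EFinM; congr EFin.
  rewrite (_ : - r = - p - (r - p)); last by ring.
  by rewrite expRD; ring.
rewrite tonelli_on//; last first.
  by rewrite /K; mfun.
rewrite {1}/gint -ge0_integralZr//; last 2 first.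
- by apply: measurable_funTS; mfun.
- by move=> x _; rewrite lee_fin mulr_ge0 ?powR_ge0 ?expR_ge0.
apply: eq_integral => r; rewrite inE in_pos => r0.
rewrite [in RHS]EFinM muleAC -beta_scale// -ge0_integralZr//; last 2 first.
- by mfun.
- by move=> x _; rewrite lee_fin !mulr_ge0 ?powR_ge0 ?expR_ge0// indicE.
under [RHS]eq_integral do rewrite -EFinM.
rewrite (itv0E r) -(integral_indicM P _ (fun p => p `^ (a - 1) * (r - p) `^ (b - 1) * expR (- r))).
apply: eq_integral => p; rewrite inE in_pos => p0.
rewrite /K !indicE; congr (((nat_of_bool _)%:R * _)%:E).
by apply/idP/idP; rewrite !inE/= !in_itv/= andbT p0 subr_gt0.
Qed.

(** The map x -> x^a preserves (0, 1), and its Jacobian a x^(a-1) is [a] times the integrand, so the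
    power substitution applied to the indicator of (0, 1) suffices, also for a < 1 where the
    integrand is unbounded. *)
Let beta1 a : 0 < a -> beta a 1 = (a^-1)%:E.
Proof.
move=> a0; pose G x := (\1_(`]0, 1[%classic : set R) x : R)%:E.
have mG : measurable_fun [set: R] G by rewrite /G; mfun.
have G0 x : (0 <= G x)%E by rewrite lee_fin indicE.
have a0' : a != 0 by rewrite gt_eqF.
have : (\int[mu]_(x in P) (G (x `^ a)%R * (`|a| * x `^ (a - 1))%:E) = 1)%E.
  rewrite (ge0_integral_powR G a a0' (measurable_funTS mG) (fun x _ => G0 x)).
  rewrite integral_indic//.
  by rewrite setIC -itv0E [LHS]lebesgue_measure_itv/= lte01 sube0.
rewrite gtr0_norm//.
have -> : (\int[mu]_(x in P) (G (x `^ a)%R * (a * x `^ (a - 1))%:E) = a%:E * beta a 1)%E.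
  rewrite /beta itv0E -integral_indicM -ge0_integralZl//; last 3 first.
  - by apply: measurable_funTS; mfun.
  - by move=> x _; rewrite lee_fin !mulr_ge0 ?powR_ge0// indicE.
  - by rewrite lee_fin ltW.
  apply: eq_integral => x; rewrite inE in_pos => x0.
  rewrite /G -!EFinM subrr powRr0 mulr1 mulrCA; congr (_ * _)%:E; congr (_ * _).
  rewrite !indicE; congr ((nat_of_bool _)%:R).
  apply/idP/idP; rewrite !inE/= !in_itv/= x0 powR_gt0//= => h; last first.
    by rewrite -[X in _ < X](powR1l a) gt0_ltr_powR// nnegrE// ltW.
  by rewrite ltNge; apply/negP => x1; move: h; rewrite ltNge -[X in X <= _](powR1l a) ge0_ler_powR ?nnegrE// ltW.
move=> /(congr1 (fun z => (a^-1)%:E * z)%E).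
by rewrite muleA -EFinM mulVf// mul1e mule1.
Qed.

Let gint1 : gint 1 = 1%E.
Proof.
rewrite /gint integral_itv_obnd_cbnd; last by apply: measurable_funTS; mfun.
have := @ge0_integration_by_substitutionNy R expR 0.
rewrite oppr0 integral_expR_Ny expR0 => ->.
- by apply: eq_integral => x _; rewrite /= subrr powRr0 mul1r.
- by apply: continuous_subspaceT => x; exact: continuous_expR.
- by move=> x _; exact: expR_ge0.
Qed.

(** The functional equation is the product formula with second argument 1. *)
Let gintS a : 0 < a -> gint (a + 1) = (a%:E * gint a)%E.
Proof.
move=> a0; have := gint_beta a 1; rewrite gint1 mule1 (beta1 a a0) => ->.
by rewrite muleCA -EFinM divff ?mule1// gt_eqF.
Qed.

(** The functional equation lowers [a] until it is at most 1. *)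
Let gint_lty a : 0 < a -> (gint a < +oo)%E.
Proof.
move=> a0; have [n an] : exists n : nat, a <= n.+1%:R.
  by exists (Num.truncn a); rewrite ltW// truncnS_gt.
elim: n a a0 an => [|n IHn] a a0 an; last first.
  have [a1|a1] := leP a 1; first by apply: IHn => //; rewrite (le_trans a1)// ler1n.
  rewrite -(subrK 1 a) gintS ?subr_gt0// lte_mul_pinfty ?lee_fin ?subr_ge0 ?(ltW a1)//.
  by apply: IHn; rewrite ?subr_gt0// lerBlDr natr1.
(* For a <= 1 the integrand is at most t^(a-1) on (0, 1) and at most exp(-t) beyond 1. *)
apply: (@le_lt_trans _ _ (beta a 1 + gint 1)%E); last first.
  by rewrite gint1 beta1// -EFinD ltry.
rewrite /beta itv0E -integral_indicM /gint -ge0_integralD//; last 4 first.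
- by move=> x _; rewrite lee_fin !mulr_ge0 ?powR_ge0// indicE.
- by apply: measurable_funTS; mfun.
- by move=> x _; rewrite lee_fin !mulr_ge0 ?powR_ge0 ?expR_ge0.
- by apply: measurable_funTS; mfun.
apply: ge0_le_integral => //.
- by move=> x _; rewrite lee_fin !mulr_ge0 ?powR_ge0 ?expR_ge0.
- by apply: measurable_funTS; mfun.
- by apply: measurable_funTS; mfun.
move=> x; rewrite in_pos => x0; rewrite -EFinD lee_fin subrr !powRr0 mulr1 mul1r.
have [x1|x1] := ltP x 1.
  rewrite indicE mem_set/= ?in_itv/= ?x0// mul1r.
  by rewrite (@le_trans _ _ (x `^ (a - 1)))// ?lerDl ?expR_ge0// ler_piMr ?powR_ge0// expR_le1 oppr_le0 ltW.
apply: (@le_trans _ _ (expR (- x))).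
  by rewrite ler_piMl ?expR_ge0// -[leRHS](powRr0 x) ler_powR// subr_le0.
by rewrite lerDr mulr_ge0 ?powR_ge0 ?indicE.
Qed.

(** On (0, 1) the exponential is at least exp(-1), whence the lower bound exp(-1) / a. *)
Let gint_gt0 a : 0 < a -> (0 < gint a)%E.
Proof.
move=> a0; apply: (@lt_le_trans _ _ ((expR (-1))%:E * beta a 1)%E).
  by rewrite beta1// -EFinM lte_fin mulr_gt0 ?expR_gt0 ?invr_gt0.
rewrite /beta itv0E -integral_indicM -ge0_integralZl//; last 2 first.
- by apply: measurable_funTS; mfun.
- by move=> x _; rewrite lee_fin !mulr_ge0 ?powR_ge0// indicE.
apply: ge0_le_integral => //.
- by move=> x _; rewrite -?EFinM lee_fin !mulr_ge0 ?powR_ge0 ?expR_ge0 ?indicE.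
- by apply: measurable_funTS; mfun.
- by apply: measurable_funTS; mfun.
move=> x; rewrite in_pos => x0; rewrite -?EFinM lee_fin subrr !powRr0 mulr1.
rewrite indicE; have [xI|xI] := boolP (x \in _); last first.
  by rewrite mul0r mulr0 mulr_ge0 ?powR_ge0 ?expR_ge0.
rewrite mul1r mulrC ler_wpM2l ?powR_ge0// ler_expR lerN2.
by move: xI; rewrite inE/= in_itv/= => /andP[_ /ltW].
Qed.

Lemma GammaE a : 0 < a ->
  ((Gamma a)%:E = \int[mu]_(t in P) (t `^ (a - 1) * expR (- t))%:E)%E.
Proof. by move=> a0; rewrite /Gamma fineK// ge0_fin_numE ?gint_lty ?gint_ge0. Qed.

Lemma Gamma_gt0 a : 0 < a -> 0 < Gamma a.
Proof. by move=> a0; rewrite -lte_fin GammaE// gint_gt0. Qed.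

Lemma GammaS a : 0 < a -> Gamma (a + 1) = a * Gamma a.
Proof.
move=> a0; apply/EFin_inj; rewrite EFinM !GammaE ?addr_gt0//.
exact: gintS.
Qed.

Let betaE a b : 0 < a -> 0 < b ->
  beta a b = (Gamma a * Gamma b / Gamma (a + b))%:E.
Proof.
move=> a0 b0; have ab0 : 0 < a + b by rewrite addr_gt0.
rewrite mulrC !EFinM !GammaE// -/(gint a) -/(gint b) gint_beta.
rewrite /gint -GammaE// muleA -EFinM mulVf ?mul1e//.
by rewrite gt_eqF// Gamma_gt0.
Qed.

Lemma integral_beta a b r : 0 < a -> 0 < b -> 0 < r ->
  (\int[mu]_(u in `]0%R, r[) (u `^ (a - 1) * (r - u) `^ (b - 1))%:E =
   (r `^ (a + b - 1) * (Gamma a * Gamma b / Gamma (a + b)))%:E)%E.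
Proof. by move=> a0 b0 r0; rewrite beta_scale// betaE. Qed.

Lemma integral_powR_expR a u : 0 < a -> 0 < u ->
  (\int[mu]_(p in P) (p `^ (a - 1) * expR (- (p * u)))%:E = (Gamma a * u `^ (- a))%:E)%E.
Proof.
move=> a0 u0; rewrite mulrC EFinM GammaE//.
rewrite -[in RHS](ge0_integral_scale _ u u0); last 2 first.
- by apply: measurable_funTS; mfun.
- by move=> x x0; rewrite lee_fin mulr_ge0 ?powR_ge0 ?expR_ge0.
rewrite -ge0_integralZl//; last 3 first.
- by apply: measurable_funTS; mfun.
- by move=> x _; rewrite -?EFinM lee_fin !mulr_ge0 ?powR_ge0 ?expR_ge0// ltW.
- by rewrite lee_fin powR_ge0.
apply: eq_integral => p; rewrite inE in_pos => p0; rewrite -!EFinM; congr EFin.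
rewrite powRM ?ltW// [u * p]mulrC.
have E1 : u `^ (- a) * (u `^ (a - 1) * u) = 1.
  rewrite -{3}(powRr1 (ltW u0)) -!gt0_powRD// (_ : - a + _ = 0) ?powRr0//; ring.
rewrite -[LHS]mul1r -[X in X * _ = _]E1; ring.
Qed.

End gamma.

Local Opaque Gamma.

Lemma ratio_test (R : realType) (d : nat -> R) : (forall n, 0 <= d n) ->
  (\forall n \near \oo, d n.+1 <= d n / 2) -> cvgn (series d).
Proof.
move=> d0 [N _ dN].
(* [M] bounds d n 2^n for every n: up to [N] this is one of the summands, and from [N] on the ratio
   condition makes d n 2^n nonincreasing. *)
pose M := \sum_(0 <= k < N.+1) d k * 2 ^+ k.
have M0 : 0 <= M by rewrite sumr_ge0// => k _; rewrite mulr_ge0// exprn_ge0.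
have dM n : (n <= N)%N -> d n * 2 ^+ n <= M.
  move=> nN; rewrite /M (big_rem n)/= ?mem_index_iota//= lerDl.
  by rewrite sumr_ge0// => k _; rewrite mulr_ge0// exprn_ge0.
have {}dM n : d n <= geometric M 2^-1 n.
  rewrite /geometric/= exprVn ler_pdivlMr ?exprn_gt0//.
  elim: n => [|n IHn]; first exact: dM.
  have [|Nn] := leqP n.+1 N; first exact: dM.
  apply: le_trans IHn; rewrite exprS mulrA ler_wpM2r ?exprn_ge0//.
  by rewrite -ler_pdivlMr//; exact: dN.
apply: (series_le_cvg d0 _ dM).
  by move=> n; apply: geometric_ge0.
by apply: is_cvg_geometric_series; rewrite ger0_norm// invf_lt1// ltr1n.
Qed.

(** * Decay of gamma quotients and convergence of the Prabhakar series *)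

Section gamma_ratio.
Context {R : realType}.
Local Notation mu := (@lebesgue_measure R).
Local Notation P := (`]0%R, +oo[%classic : set R).
Implicit Types (a b g l : R).

(** Up to the factor Gamma(a) the quotient is the beta integral of u^(an+b-1) (1-u)^(a-1). On (0, 1)
    this integrand tends to 0 and is dominated by its value at n = 0. *)
Lemma Gamma_ratio_cvg0 a b : 0 < a -> 0 < b ->
  Gamma (a * n%:R + b) / Gamma (a * n%:R + b + a) @[n --> \oo] --> 0.
Proof.
move=> a0 b0.
have ab0 n : 0 < a * n%:R + b by rewrite ltr_wpDl// mulr_ge0// ltW.
pose f n (u : R) := (u `^ (a * n%:R + b - 1) * (1 - u) `^ (a - 1))%:E.
have If n : (\int[mu]_(u in `]0%R, 1%R[) f n u =
    (Gamma a * (Gamma (a * n%:R + b) / Gamma (a * n%:R + b + a)))%:E)%E.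
  by rewrite /f integral_beta// powR1l mul1r; congr EFin; ring.
have mf n : measurable_fun (`]0, 1[%classic : set R) (f n) by rewrite /f; mfun.
have f0 n u : (0 <= f n u)%E by rewrite lee_fin mulr_ge0 ?powR_ge0.
have [|||_ _] := @dominated_convergence _ _ _ mu (`]0, 1[%classic : set R) (measurable_itv _) f (cst 0%E) (f 0%N) mf (measurable_cst _).
- apply: aeW => u; rewrite /= in_itv/= => /andP[u0 u1].
  apply: cvg_EFin; first exact: nearW.
  rewrite (_ : _ \o _ = fun n => (u `^ a) ^+ n * (u `^ (b - 1) * (1 - u) `^ (a - 1))); last first.
    apply/funext => n /=; rewrite mulrA; congr (_ * _).
    by rewrite -addrA (gt0_powRD _ (a * n%:R))// powRrM powR_mulrn// powR_ge0.
  rewrite -[X in _ --> X](mul0r (u `^ (b - 1) * (1 - u) `^ (a - 1))).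
  apply: cvgMl; apply: cvg_expr; rewrite ger0_norm ?powR_ge0//.
  by rewrite -[X in _ < X](powR1l a) gt0_ltr_powR// nnegrE// ltW.
- apply/integrableP; split; first exact: (mf 0%N).
  by under eq_integral do rewrite gee0_abs//; rewrite If ltry.
- apply: aeW => u n; rewrite (gee0_abs (f0 n u)) /= in_itv/= => /andP[u0 u1].
  rewrite lee_fin ler_wpM2r ?powR_ge0// mulr0 add0r.
  apply: ger_powR; first by rewrite u0 ltW.
  by rewrite !lerD2r lerDr mulr_ge0// ltW.
rewrite /= integral0.
under eq_fun do rewrite If.
move=> /fine_cvg/= h.
have -> : (fun n => Gamma (a * n%:R + b) / Gamma (a * n%:R + b + a)) =
   (fun n => (Gamma a)^-1 * (Gamma a * (Gamma (a * n%:R + b) / Gamma (a * n%:R + b + a)))).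
  by apply/funext => n; rewrite [RHS]mulrA mulVf ?mul1r// gt_eqF// Gamma_gt0.
by rewrite -(mulr0 (Gamma a)^-1); apply: cvgMr.
Qed.

(** The prefactor 1 / Gamma(g) of [prabhakar] is left out; it is restored in [prabhakar_mixture]. *)
Definition prabhakar_coef g a b (k : nat) : R := Gamma (g + k%:R) / ((k`!)%:R * Gamma (a * k%:R + b)).

Lemma prabhakar_coef_gt0 g a b k : 0 < g -> 0 < a -> 0 < b -> 0 < prabhakar_coef g a b k.
Proof.
move=> g0 a0 b0; rewrite divr_gt0 ?mulr_gt0 ?Gamma_gt0 ?ltr0n ?fact_gt0//.
  by rewrite ltr_wpDr.
by rewrite ltr_wpDl// mulr_ge0// ltW.
Qed.

(** Consecutive coefficients have quotient (g+n)/(n+1) times a gamma quotient that tends to 0; the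
    first factor is at most g + 1, so the ratio test applies for every [y]. *)
Lemma cvg_prabhakar_series g a b y : 0 < g -> 0 < a -> 0 < b -> 0 <= y ->
  cvgn (series (fun k => prabhakar_coef g a b k * y ^+ k)).
Proof.
move=> g0 a0 b0 y0; apply: ratio_test.
  by move=> n; rewrite mulr_ge0 ?exprn_ge0// ltW// prabhakar_coef_gt0.
have ab0 n : 0 < a * n%:R + b by rewrite ltr_wpDl// mulr_ge0// ltW.
(* The threshold makes y (g+1) times the gamma quotient at most 1/2; y + 1 replaces [y] to allow y =
   0. *)
have C0 : 0 < (2 * ((g + 1) * (y + 1)))^-1.
  by rewrite invr_gt0 !mulr_gt0// ltr_wpDl// ltW.
have := Gamma_ratio_cvg0 a b a0 b0.
move=> /cvgrPdist_le/(_ _ C0); apply: filterS => n.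
set r := Gamma _ / _; rewrite sub0r normrN.
have r0 : 0 < r by rewrite /r divr_gt0// Gamma_gt0// addr_gt0.
rewrite gtr0_norm// => rC.
have gn0 : 0 < g + n%:R by rewrite ltr_wpDr.
have -> : prabhakar_coef g a b n.+1 = prabhakar_coef g a b n * ((g + n%:R) / n.+1%:R * r).
  rewrite /prabhakar_coef /r -natr1 addrA GammaS// mulrDr mulr1 addrAC factS natrM -[n.+1%:R]natr1.
  have aba0 : 0 < a * n%:R + b + a by rewrite addr_gt0.
  have n10 : 0 < 1 + n%:R :> R by rewrite ltr_wpDr.
  have h1 := lt0r_neq0 (Gamma_gt0 _ (ab0 n)); have h2 := lt0r_neq0 (Gamma_gt0 _ aba0).
  have h3 : n`!%:R != 0 :> R by rewrite pnatr_eq0 -lt0n fact_gt0.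
  move: (Gamma (a * n%:R + b)) (Gamma (a * n%:R + b + a)) h1 h2 => A B h1 h2.
  by field; rewrite h1 h2 h3 gt_eqF.
have c0 := prabhakar_coef_gt0 g a b n g0 a0 b0.
rewrite [leLHS](_ : _ = prabhakar_coef g a b n * y ^+ n * (y * ((g + n%:R) / n.+1%:R * r))); last first.
  by rewrite exprSr; ring.
apply: ler_wpM2l; first by rewrite (mulr_ge0 (ltW c0))// exprn_ge0.
have n10 : 0 < n.+1%:R :> R by rewrite ltr0n.
have h1 : (g + n%:R) / n.+1%:R <= g + 1.
  rewrite ler_pdivrMr// -natr1 mulrDr mulr1 mulrDl mul1r.
  have := ler0n R n; nra.
apply: (@le_trans _ _ ((y + 1) * ((g + 1) * (2 * ((g + 1) * (y + 1)))^-1))).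
  have h0 : 0 <= (g + n%:R) / n.+1%:R by rewrite divr_ge0// ltW.
  have h2 : (g + n%:R) / n.+1%:R * r <= (g + 1) * (2 * ((g + 1) * (y + 1)))^-1.
    exact: (ler_pM h0 (ltW r0) h1 rC).
  apply: (ler_pM y0 _ _ h2); first by rewrite mulr_ge0// ltW.
  by rewrite lerDl.
rewrite le_eqVlt; apply/orP; left; apply/eqP; field.
by rewrite !gt_eqF// ?ltr_wpDl// ltW.
Qed.

End gamma_ratio.

(** * Term by term integration against the exponential *)

Section moments.
Context {R : realType}.
Local Notation mu := (@lebesgue_measure R).
Local Notation P := (`]0%R, +oo[%classic : set R).
Variables (q : nat -> R).

Section real_valued.
Variable g : R -> R.
Hypotheses (mg : measurable_fun P g) (g0 : forall t : R, 0 < t -> 0 <= g t).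
Hypothesis gq : forall k : nat, (\int[mu]_(t in P) (g t * t ^+ k)%:E = (q k)%:E)%E.

Let mgX (h : R -> R) : measurable_fun P h -> measurable_fun P (fun t => (g t * h t)%:E).
Proof. by move=> mh; apply: measurable_fun_EFin; exact: measurable_funM. Qed.

Let integrable_moment k : mu.-integrable P (fun t => (g t * t ^+ k)%:E).
Proof.
apply/integrableP; split.
  by apply: mgX; exact: measurable_funX.
under eq_integral => t do [rewrite inE in_pos => t0; rewrite gee0_abs ?lee_fin ?mulr_ge0 ?g0 ?exprn_ge0 ?ltW//].
by rewrite gq ltry.
Qed.

(** Integrability is carried through the induction because the coefficients may have any sign, so
    additivity of the integral needs it. *)
Let moment_sum (c : nat -> R) n :
  mu.-integrable P (fun t => (g t * series (fun k => c k * t ^+ k) n)%:E) /\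
  (\int[mu]_(t in P) (g t * series (fun k => c k * t ^+ k) n)%:E =
   (series (fun k => c k * q k) n)%:E)%E.
Proof.
elim: n => [|n [IHi IHe]].
  have -> : (fun t => (g t * series (fun k => c k * t ^+ k) 0)%:E) = cst 0%E.
    by apply/funext => t; rewrite seriesEnat/= big_geq// mulr0.
  split; first exact: integrable0.
  by rewrite integral0 seriesEnat/= big_geq.
have E : (fun t => (g t * series (fun k => c k * t ^+ k) n.+1)%:E) =
   (fun t => (g t * series (fun k => c k * t ^+ k) n)%:E) \+
   (fun t => ((c n)%:E * (g t * t ^+ n)%:E)%E).
  apply/funext => t; rewrite seriesSr/= -EFinM -EFinD; congr EFin; ring.
rewrite E; split.
  by apply: integrableD => //; apply: integrableZl.
rewrite integralD//; last exact: integrableZl.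
by rewrite IHe integralZl// gq seriesSr.
Qed.

Let exp_series (l t : R) n :
  series (fun k => (l ^+ k / k`!%:R) * t ^+ k) n = series (exp_coeff (l * t)) n.
Proof.
by rewrite !seriesEnat/=; apply: eq_bigr => k _; rewrite /exp_coeff/= exprMn mulrAC.
Qed.

Let cvg_exp (x : R) : series (exp_coeff x) n @[n --> \oo] --> expR x.
Proof. exact: is_cvg_series_exp_coeff. Qed.

Lemma real_moments_expansion (l : R) : 0 <= l ->
  cvgn (series (fun k => l ^+ k / k`!%:R * q k)) ->
  ((fun n => (series (fun k => (- l) ^+ k / k`!%:R * q k) n)%:E) @ \oo -->
   \int[mu]_(t in P) (g t * expR (- (l * t)))%:E)%E.
Proof.
move=> l0 cvgq.
have mexp (c : R) : measurable_fun P (fun t => expR (c * t)).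
  by apply: measurable_funTS; mfun.
have ndS (t : R) : 0 < t -> nondecreasing_seq (series (exp_coeff (l * t))).
  move=> t0; apply: nondecreasing_series => k _ _; apply: exp_coeff_ge0.
  by rewrite mulr_ge0// ltW.
have Sge0 (t : R) n : 0 < t -> 0 <= series (exp_coeff (l * t)) n.
  move=> t0; rewrite seriesEnat/= sumr_ge0// => k _; apply: exp_coeff_ge0.
  by rewrite mulr_ge0// ltW.
have mS (c : R) n : measurable_fun P (fun t => (g t * series (exp_coeff (c * t)) n)%:E).
  have [/measurable_int + _] := moment_sum (fun k => c ^+ k / k`!%:R) n.
  by apply: eq_measurable_fun => t _; rewrite exp_series.
have IS (c : R) n : (\int[mu]_(t in P) (g t * series (exp_coeff (c * t)) n)%:E =
    (series (fun k => c ^+ k / k`!%:R * q k) n)%:E)%E.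
  have [_ <-] := moment_sum (fun k => c ^+ k / k`!%:R) n.
  by apply: eq_integral => t _; rewrite exp_series.
have cvgS (c t : R) : ((g t * series (exp_coeff (c * t)) n)%:E @[n --> \oo] --> (g t * expR (c * t))%:E)%E.
  by apply: cvg_EFin; [exact: nearW|apply: cvgMr; exact: cvg_exp].
(* This is the majorant. Its integral is the limit, by monotone convergence, of the integrals of the
   partial sums of the exponential series at +l, that is, the series assumed to converge. *)
have intg : mu.-integrable P (fun t => (g t * expR (l * t))%:E).
  apply/integrableP; split; first exact: mgX.
  rewrite (_ : (\int[mu]_(t in P) _ = \int[mu]_(t in P) limn (fun n => (g t * series (exp_coeff (l * t)) n)%:E))%E); last first.
    apply: eq_integral => t; rewrite inE in_pos => t0.
    rewrite gee0_abs ?lee_fin ?mulr_ge0 ?g0 ?expR_ge0//.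
    by apply/esym/cvg_lim => //; exact: cvgS.
  rewrite monotone_convergence//.
  - under eq_fun do rewrite IS.
    by rewrite (EFin_lim (f := series (fun k => l ^+ k / k`!%:R * q k)))// ltry.
  - exact: (mS l).
  - by move=> n t; rewrite in_pos => t0; rewrite lee_fin mulr_ge0 ?g0 ?Sge0.
  - move=> t; rewrite in_pos => t0 m n mn; rewrite lee_fin ler_wpM2l ?g0//.
    exact: ndS.
have [|||_ _] := @dominated_convergence _ _ _ mu P (measurable_itv _)
    (fun n t => (g t * series (exp_coeff (- l * t)) n)%:E)
    (fun t => (g t * expR (- l * t))%:E) (fun t => (g t * expR (l * t))%:E) (mS (- l)) (mgX _ (mexp _)).
- by apply: aeW => t _; exact: cvgS.
- exact: intg.
- apply: aeW => t n; rewrite in_pos => t0; rewrite abse_EFin lee_fin normrM (ger0_norm (g0 t t0)).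
  rewrite ler_wpM2l ?g0//.
  (* Taking absolute values term by term turns a partial sum at -l into the one at +l, which stays
     below the exponential. *)
  apply: (@le_trans _ _ (series (exp_coeff (l * t)) n)); last first.
    by apply: nondecreasing_cvgn_le; [exact: ndS|exact: is_cvg_series_exp_coeff].
  rewrite !seriesEnat/= (le_trans (ler_norm_sum _ _ _))// ler_sum// => k _.
  rewrite /exp_coeff/= normrM normrX mulNr normrN.
  by rewrite (ger0_norm (mulr_ge0 l0 (ltW t0))) ger0_norm ?invr_ge0.
rewrite /=.
under eq_fun do rewrite IS.
by under eq_integral do rewrite mulNr.
Qed.

End real_valued.

(* [G] may be infinite on a null set, so one first passes to its finite part. *)
Lemma moments_expansion (G : R -> \bar R) (l : R) :
  measurable_fun P G -> (forall t : R, 0 < t -> (0 <= G t)%E) ->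
  (forall k : nat, (\int[mu]_(t in P) (G t * (t ^+ k)%:E) = (q k)%:E)%E) ->
  0 <= l -> cvgn (series (fun k => l ^+ k / k`!%:R * q k)) ->
  (\int[mu]_(t in P) (G t * (expR (- (l * t)))%:E) =
   (limn (series (fun k => (- l) ^+ k / k`!%:R * q k)))%:E)%E.
Proof.
move=> mG G0 Gq l0 cvgq.
(* The moment of order 0 is finite, which makes [G] integrable and hence finite almost
   everywhere. *)
have intG : mu.-integrable P G.
  apply/integrableP; split => //.
  under eq_integral => t do [rewrite inE in_pos => t0; rewrite gee0_abs ?G0// -[G t]mule1 -(expr0 t)].
  by rewrite Gq ltry.
pose g := fine \o G.
have mg : measurable_fun P g.
  exact: measurableT_comp.
have g0 (t : R) : 0 < t -> 0 <= g t by move=> t0; apply: fine_ge0; exact: G0.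
have aeG (h : R -> R) : measurable_fun P h ->
    (\int[mu]_(t in P) (G t * (h t)%:E) = \int[mu]_(t in P) (g t * h t)%:E)%E.
  move=> mh; apply: ae_eq_integral => //.
  - by apply: emeasurable_funM => //; exact: measurable_fun_EFin.
  - by apply: measurable_fun_EFin; exact: measurable_funM.
  - have := integrable_ae _ intG; move=> /(_ (measurable_itv _)); apply: filterS => t fG /fG Gt.
    by rewrite EFinM /g/= fineK.
have gq k : (\int[mu]_(t in P) (g t * t ^+ k)%:E = (q k)%:E)%E.
  by rewrite -Gq aeG//; exact: measurable_funX.
rewrite aeG; last by apply: measurable_funTS; mfun.
have h := real_moments_expansion g mg g0 gq l l0 cvgq.
(* The [q k] are nonnegative as moments of [g], so the absolute values of the terms are the terms of
   the series at +l. *)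
have cq : cvgn (series (fun k => (- l) ^+ k / k`!%:R * q k)).
  apply: normed_cvg; rewrite [X in cvgn X](_ : _ = series (fun k => l ^+ k / k`!%:R * q k))//.
  congr series; apply/funext => k /=.
  have qk0 : 0 <= q k.
    rewrite -lee_fin -gq; apply: integral_ge0 => t; rewrite in_pos => t0.
    by rewrite lee_fin mulr_ge0 ?g0// exprn_ge0// ltW.
  by rewrite !normrM normrX normrN (ger0_norm l0) (ger0_norm qk0) ger0_norm ?invr_ge0.
by rewrite -[RHS](EFin_lim cq); apply/esym/cvg_lim.
Qed.

End moments.

(** * Moments of stable densities *)

Section stable.
Context {R : realType}.
Local Notation mu := (@lebesgue_measure R).
Local Notation P := (`]0%R, +oo[%classic : set R).
Variables (alpha : R) (f : R -> R).
Hypotheses (a0 : 0 < alpha) (a1 : alpha < 1) (df : stable_density alpha f).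

Let mf : measurable_fun [set: R] f. Proof. by case: df. Qed.
Let f0 x : 0 < x -> 0 <= f x. Proof. by case: df => _ h _ _ x0; apply: h; rewrite ltW. Qed.

Let laplace s : 0 <= s ->
  (\int[mu]_(u in P) (expR (- (s * u)) * f u)%:E = (expR (- (s `^ alpha)))%:E)%E.
Proof.
move=> s0; have [_ _ _ h] := df; rewrite -h// integral_itv_obnd_cbnd//.
by apply: measurable_funTS; mfun.
Qed.

Let integrable_laplace s : 0 <= s ->
  mu.-integrable P (EFin \o (fun u => expR (- (s * u)) * f u)).
Proof.
move=> s0; apply/integrableP; split.
  by apply: measurable_fun_EFin; apply: measurable_funTS; mfun.
under eq_integral => u do [rewrite inE in_pos => u0; rewrite gee0_abs ?lee_fin ?mulr_ge0 ?f0 ?expR_ge0//].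
by rewrite laplace// ltry.
Qed.

(** Differentiation of the Laplace transform under the integral sign at [p], on the neighbourhood
    (p/2, p+1), which stays away from 0. *)
Let laplace_derivative p : 0 < p ->
  (\int[mu]_(u in P) (u * f u * expR (- (p * u)))%:E =
   (alpha * p `^ (alpha - 1) * expR (- (p `^ alpha)))%:E)%E.
Proof.
move=> p0.
pose h (q u : R) := expR (- (q * u)) * f u.
have h' (q u : R) : is_derive q 1 (h ^~ u) (- (u * f u * expR (- (q * u)))).
  rewrite /h; apply: is_derive_eq.
  rewrite /GRing.scale/= ; ring.
have p2 : 0 < p / 2 by rewrite divr_gt0.
have Ip : (`]p / 2, p + 1[%classic : set R) p.
  by rewrite /= in_itv/= ltrDl ltr01 andbT; lra.
have I0 q : (`]p / 2, p + 1[%classic : set R) q -> 0 < q.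
  by rewrite /= in_itv/= => /andP[+ _]; apply: lt_trans.
have hd (q u : R) : partial1of2 h q u = - (u * f u * expR (- (q * u))).
  by rewrite partial1of2E; exact: derive_val.
(* For q > p/2 one has (p/2) u <= exp((p/2) u) <= exp(q u), so u exp(-q u) is at most 1 / (p/2). The
   absolute value keeps [G] nonnegative at negative [u] as well. *)
pose G (u : R) := (p / 2)^-1 * `|f u|.
have intG : mu.-integrable P (EFin \o G).
  apply: (@integrableZl _ _ _ mu P measurable_pos (p / 2)^-1 (fun u => `|f u|%:E)).
  have := integrable_laplace 0 (lexx _).
  move=> /integrable_abse; congr (mu.-integrable _ _); apply/funext => u /=.
  by rewrite mul0r oppr0 expR0 mul1r.
have X0 (u : R) : 0 < u -> 0 <= u * f u * expR (- (p * u)).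
  by move=> u0; rewrite !mulr_ge0 ?f0 ?expR_ge0// ltW.
have dG (q u : R) : p / 2 < q -> 0 < u -> u * f u * expR (- (q * u)) <= G u.
  move=> pq u0; rewrite /G (ger0_norm (f0 u u0)) ler_pdivlMl//.
  rewrite [leLHS](_ : _ = f u * ((p / 2 * u) * expR (- (q * u)))); last by ring.
  rewrite ler_piMr ?f0// expRN ler_pdivrMr ?expR_gt0// mul1r.
  apply: (@le_trans _ _ (expR (p / 2 * u))); last by rewrite ler_expR ler_pM2r// ltW.
  by apply: le_trans (expR_ge1Dx _); rewrite lerDr.
have D := @differentiation_under_integral R _ _ mu h P measurable_pos p (p / 2) (p + 1) Ip
  (fun q Iq => integrable_laplace q (ltW (I0 q Iq)))
  (fun q u _ _ => @ex_derive _ _ _ _ _ _ _ (h' q u)) G.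
have G0 u : 0 <= G u by rewrite mulr_ge0// invr_ge0 ltW.
have Gb (q u : R) : `]p / 2, p + 1[%classic q -> P u -> `|partial1of2 h q u| <= G u.
  rewrite in_pos /= in_itv/= => /andP[pq _] u0; rewrite hd normrN ger0_norm ?dG//.
  by rewrite !mulr_ge0 ?f0 ?expR_ge0// ltW.
move: D => /(_ G0 intG Gb) D.
(* The differentiation theorem speaks of real-valued integrals, so finiteness is needed to return to
   the extended-real one. *)
have finX : (\int[mu]_(u in P) (u * f u * expR (- (p * u)))%:E)%E \is a fin_num.
  rewrite ge0_fin_numE; last by apply: integral_ge0 => u; rewrite in_pos lee_fin; exact: X0.
  have /integrableP[mG] := intG; apply: le_lt_trans; apply: ge0_le_integral => //.
  - by move=> u; rewrite in_pos lee_fin; exact: X0.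
  - by apply: measurable_funTS; mfun.
  - exact: measurableT_comp.
  - move=> u; rewrite in_pos => u0; rewrite lee_fin ger0_norm; last first.
      by rewrite mulr_ge0// invr_ge0 ltW.
    by apply: dG => //; move: Ip; rewrite /= in_itv/= => /andP[].
have -> : (\int[mu]_(u in P) (u * f u * expR (- (p * u)))%:E =
    (- \int[mu]_(u in P) partial1of2 h p u)%R%:E)%E.
  rewrite /Rintegral; under [in RHS]eq_integral do rewrite hd EFinN.
  rewrite integral_ge0N; last by move=> u; rewrite in_pos lee_fin; exact: X0.
  by rewrite fineN opprK fineK.
rewrite -D; congr EFin; rewrite derive1E.
rewrite (@near_eq_derive _ _ _ _ (fun q : R => expR (- (q `^ alpha)))); last first.
  near=> q; rewrite /= /Rintegral laplace//; apply: ltW; near: q; exact: lt_nbhsr.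
have dp := is_derive1_powR alpha p0.
have : is_derive p (1 : R) (fun q : R => expR (- q `^ alpha)) (- (alpha * p `^ (alpha - 1) * expR (- p `^ alpha))).
  by apply: is_derive_eq; rewrite /GRing.scale/=; ring.
by move=> /@derive_val ->; rewrite opprK.
Unshelve. all: by end_near. Qed.

(** The double integral of u f(u) p^s exp(-p u) is evaluated in both orders: over [p] first it gives
    Gamma(1+s) times the moment; over [u] first it gives the derivative formula, and the
    substitution p^alpha turns the rest into Gamma(1 + s/alpha). The bound on [s] is the positivity
    of 1 + s/alpha; with alpha < 1 it also gives 1 + s > 0. *)
Let stable_moment (s : R) : - alpha < s ->
  (\int[mu]_(u in P) (u `^ (- s) * f u)%:E = (Gamma (1 + s / alpha) / Gamma (1 + s))%:E)%E.
Proof.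
move=> as_.
have s1 : 0 < 1 + s by rewrite addrC -ltrBlDr sub0r (lt_trans _ as_)// ltrN2.
have sa1 : 0 < 1 + s / alpha.
  by rewrite -(@ltr_pM2l _ alpha)// mulr0 mulrDr mulr1 mulrCA divff ?gt_eqF// mulr1 addrC -ltrBlDr sub0r.
pose K u p := (u * f u * (p `^ s * expR (- (p * u))))%:E.
have I1 : (\int[mu]_(u in P) \int[mu]_(p in P) K u p =
    (Gamma (1 + s))%:E * \int[mu]_(u in P) (u `^ (- s) * f u)%:E)%E.
  rewrite -ge0_integralZl//; last 3 first.
  - by apply: measurable_funTS; mfun.
  - by move=> u; rewrite in_pos => u0; rewrite lee_fin mulr_ge0 ?powR_ge0 ?f0.
  - by rewrite lee_fin ltW// Gamma_gt0.
  apply: eq_integral => u; rewrite inE in_pos => u0.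
  under eq_integral do rewrite /K EFinM.
  rewrite ge0_integralZl//; last 3 first.
  - by apply: measurable_funTS; mfun.
  - by move=> p _; rewrite lee_fin mulr_ge0 ?powR_ge0 ?expR_ge0.
  - by rewrite lee_fin mulr_ge0 ?f0// ltW.
  have -> : (\int[mu]_(p in P) (p `^ s * expR (- (p * u)))%:E =
      (Gamma (1 + s) * u `^ (- (1 + s)))%:E)%E.
    by rewrite -(integral_powR_expR (1 + s) u)// addrC addrA addNr add0r.
  rewrite -!EFinM; congr EFin.
  rewrite (_ : - s = 1 + - (1 + s)); last by ring.
  by rewrite gt0_powRD// powRr1 ?ltW//; ring.
have I2 : (\int[mu]_(u in P) \int[mu]_(p in P) K u p = (Gamma (1 + s / alpha))%:E)%E.
  rewrite tonelli_on//; last 2 first.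
  - rewrite /K; mfun; exact: measurableT_comp.
  - by move=> u p; rewrite in_pos => u0 _; rewrite lee_fin !mulr_ge0 ?f0 ?powR_ge0 ?expR_ge0// ltW.
  rewrite GammaE//.
  rewrite -[RHS](ge0_integral_powR _ alpha (lt0r_neq0 a0)); last 2 first.
  - by apply: measurable_funTS; mfun.
  - by move=> x _; rewrite lee_fin mulr_ge0 ?powR_ge0 ?expR_ge0.
  apply: eq_integral => p; rewrite inE in_pos => p0.
  under eq_integral => u _.
    rewrite /K (_ : _ * _ = p `^ s * (u * f u * expR (- (p * u)))); last by ring.
    rewrite EFinM; over.
  rewrite ge0_integralZl//; last 3 first.
  - by apply: measurable_funTS; mfun.
  - by move=> u; rewrite in_pos => u0; rewrite lee_fin !mulr_ge0 ?f0 ?powR_ge0 ?expR_ge0// ltW.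
  - by rewrite lee_fin powR_ge0.
  rewrite laplace_derivative// -!EFinM; congr EFin.
  rewrite gtr0_norm// -powRrM (_ : alpha * (1 + s / alpha - 1) = s); first by ring.
  by rewrite addrC addrA addNr add0r mulrCA divff ?mulr1// gt_eqF.
rewrite I1 in I2.
have g0 := Gamma_gt0 _ s1.
move: I2 => /(congr1 (fun z => ((Gamma (1 + s))^-1)%:E * z)%E).
by rewrite muleA -EFinM mulVf ?gt_eqF// mul1e -EFinM mulrC.
Qed.

(** Substitute y = u t^(-1/alpha) in the stable moment with s = alpha c. In the exponent of t, the
    part -1/alpha - 1 is the Jacobian and [c] comes from y^(-s). *)
Lemma stable_mixture_moment (c u : R) : -1 < c -> 0 < u ->
  (\int[mu]_(t in P) (f (u * t `^ (- alpha^-1)) * t `^ (c - alpha^-1 - 1))%:E =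
   (alpha * u `^ (alpha * c - 1) * (Gamma (1 + c) / Gamma (1 + alpha * c)))%:E)%E.
Proof.
move=> c1 u0.
have := stable_moment (alpha * c).
rewrite [alpha * c / _]mulrAC divff ?gt_eqF// mul1r => /(_ _) M.
have {M} := M (ltac:(by rewrite -mulrN1 ltr_pM2l)).
pose G y := (y `^ (- (alpha * c)) * f y)%:E.
have mG : measurable_fun [set: R] G by rewrite /G; mfun.
have G0 y : 0 < y -> (0 <= G y)%E by move=> y0; rewrite lee_fin mulr_ge0 ?powR_ge0 ?f0.
have mG' : measurable_fun P (fun z => G (u * z)%R * u%:E)%E.
  apply: measurable_funTS; rewrite /G; under eq_fun do rewrite -EFinM.
  by mfun; apply: measurableT_comp => //; mfun.
rewrite -(ge0_integral_scale G u u0 (measurable_funTS mG) G0).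
have p0 : - alpha^-1 != 0 by rewrite oppr_eq0 invr_eq0 gt_eqF.
rewrite -(ge0_integral_powR _ _ p0 mG'); last first.
  by move=> z z0; rewrite mule_ge0 ?G0 ?mulr_gt0// lee_fin ltW.
move=> E; rewrite EFinM -E -ge0_integralZl//; last 3 first.
- apply: emeasurable_funM; last by (apply: measurable_funTS; mfun).
  apply: (measurable_comp_pos _ (fun t : R => t `^ (- alpha^-1)) mG').
    exact: measurable_funTS.
  by move=> t t0; exact: powR_gt0.
- move=> t; rewrite in_pos => t0; rewrite !mule_ge0 ?G0 ?mulr_gt0 ?powR_gt0// lee_fin.
    exact: ltW.
  by rewrite mulr_ge0 ?powR_ge0.
- by rewrite lee_fin mulr_ge0 ?powR_ge0 ?ltW.
apply: eq_integral => t; rewrite inE in_pos => t0.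
rewrite /G -!EFinM; congr EFin.
rewrite normrN gtr0_norm ?invr_gt0// powRM ?powR_ge0 ?ltW// -powRrM.
have -> : - alpha^-1 * - (alpha * c) = c by field; rewrite gt_eqF.
have -> : t `^ (c - alpha^-1 - 1) = t `^ c * t `^ (- alpha^-1 - 1).
  by rewrite -gt0_powRD// addrA.
have U : u `^ (alpha * c - 1) * u `^ (- (alpha * c)) * u = 1.
  rewrite -[X in _ * X = _](powRr1 (ltW u0)) -!gt0_powRD//.
  by rewrite (_ : _ + 1 = 0) ?powRr0//; ring.
have A : alpha * alpha^-1 = 1 by rewrite divff// gt_eqF.
rewrite [RHS](_ : _ = (alpha * alpha^-1) * (u `^ (alpha * c - 1) * u `^ (- (alpha * c)) * u) *
  (f (u * t `^ (- alpha^-1)) * (t `^ c * t `^ (- alpha^-1 - 1)))); last by ring.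
by rewrite U A !mul1r.
Qed.

(** The endpoints form a null set; on the open interval the scaling lemma and the beta integral
    apply. *)
Lemma RL_int_open (nu : R) (g : R -> R) (x : R) : nu != 0 -> measurable_fun [set: R] g ->
  RL_int nu g x = (((Gamma nu)^-1)%:E *
    \int[mu]_(u in `]0%R, x[) ((x - u) `^ (nu - 1) * g u)%:E)%E.
Proof.
move=> nu0 mg; rewrite /RL_int (negbTE nu0); congr (_ * _)%E.
have mh : measurable_fun [set: R] (fun u => ((x - u) `^ (nu - 1) * g u)%:E) by mfun.
by rewrite -integral_itv_bndo_bndc -?integral_itv_obnd_cbnd//; exact: measurable_funTS.
Qed.

Lemma measurable_stable_scaled (t : R) : measurable_fun [set: R] (stable_scaled alpha f t).
Proof.
by apply: measurable_funM => //; apply: measurableT_comp => //; mfun.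
Qed.

Let scaled_kernel (nu x : R) (t u : R) : \bar R :=
  ((x - u) `^ (nu - 1) * stable_scaled alpha f t u)%:E.

Let measurable_scaled_kernel (nu x : R) :
  measurable_fun [set: R * R] (fun z => scaled_kernel nu x z.1 z.2).
Proof.
rewrite /scaled_kernel /stable_scaled; mfun.
by apply: measurableT_comp => //; mfun.
Qed.

Let scaled_ge0 (t u : R) : 0 < t -> 0 < u -> 0 <= stable_scaled alpha f t u.
Proof. by move=> t0 u0; rewrite mulr_ge0 ?powR_ge0// f0// mulr_gt0// powR_gt0. Qed.

Lemma RL_int_scaled_ge0 (nu x t : R) : 0 <= nu -> 0 < x -> 0 < t ->
  (0 <= RL_int nu (stable_scaled alpha f t) x)%E.
Proof.
move=> nu_ge0 x0 t0; have [->|nu0] := eqVneq nu 0.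
  by rewrite /RL_int eqxx lee_fin scaled_ge0.
have nu_gt0 : 0 < nu by rewrite lt0r nu0.
rewrite RL_int_open//; last exact: measurable_stable_scaled.
apply: mule_ge0; first by rewrite lee_fin invr_ge0 ltW// Gamma_gt0.
apply: integral_ge0 => u; rewrite /= in_itv/= => /andP[u0 _].
by rewrite lee_fin mulr_ge0 ?powR_ge0 ?scaled_ge0.
Qed.

Lemma measurable_RL_int_scaled (nu x : R) : 0 < x ->
  measurable_fun P (fun t => RL_int nu (stable_scaled alpha f t) x).
Proof.
move=> x0; have [->|nu0] := eqVneq nu 0.
  rewrite /RL_int eqxx /stable_scaled; apply: measurable_funTS; mfun.
  by apply: measurableT_comp => //; mfun.
rewrite (_ : (fun t => _) = fun t => (((Gamma nu)^-1)%:E *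
    \int[mu]_(u in `]0%R, x[) scaled_kernel nu x t u)%E); last first.
  by apply/funext => t; rewrite (RL_int_open _ _ _ nu0 (measurable_stable_scaled t)).
apply: measurable_funeM.
apply: (measurable_integral_on _ _ _ measurable_pos (measurable_itv _) (measurable_scaled_kernel nu x)).
move=> t u; rewrite in_pos /= in_itv/= => t0 /andP[u0 _].
by rewrite lee_fin mulr_ge0 ?powR_ge0 ?scaled_ge0.
Qed.

(** By Tonelli the t-moment may be taken inside the fractional integral, where it is a multiple of
    u^(alpha c - 1); the fractional integral of a power is a beta integral. *)
Lemma RL_int_scaled_moment (nu x c : R) : 0 <= nu -> 0 < x -> 0 < c ->
  (\int[mu]_(t in P) (RL_int nu (stable_scaled alpha f t) x * (t `^ (c - 1))%:E) =
   (x `^ (nu + alpha * c - 1) * (Gamma c / Gamma (nu + alpha * c)))%:E)%E.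
Proof.
move=> nu_ge0 x0 c0.
have ac0 : 0 < alpha * c by rewrite mulr_gt0.
(* Since c > 0, the functional equation absorbs the factor alpha: alpha Gamma(1+c) / Gamma(1 + alpha
   c) = Gamma(c) / Gamma(alpha c). *)
have M0 u : 0 < u ->
    (\int[mu]_(t in P) (stable_scaled alpha f t u * t `^ (c - 1))%:E =
     (u `^ (alpha * c - 1) * (Gamma c / Gamma (alpha * c)))%:E)%E.
  move=> u0; transitivity (alpha * u `^ (alpha * c - 1) * (Gamma (1 + c) / Gamma (1 + alpha * c)))%:E.
    have c1 : -1 < c by rewrite (lt_trans _ c0)// oppr_lt0.
    rewrite -(stable_mixture_moment c u c1 u0).
    apply: eq_integral => t; rewrite inE in_pos => t0; rewrite /stable_scaled -mulrA.
    congr (_ * _)%:E; rewrite -gt0_powRD//; congr (_ `^ _); ring.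
  congr EFin; rewrite ![1 + _]addrC !GammaS//.
  by field; rewrite !gt_eqF ?Gamma_gt0.
have [->|nu0] := eqVneq nu 0.
  rewrite add0r -M0//; apply: eq_integral => t _.
  by rewrite /RL_int eqxx EFinM.
have nu_gt0 : 0 < nu by rewrite lt0r nu0.
have k0 t u : 0 < t -> 0 < u < x -> (0 <= scaled_kernel nu x t u)%E.
  by move=> t0 /andP[u0 _]; rewrite lee_fin mulr_ge0 ?powR_ge0 ?scaled_ge0.
pose K t u := ((x - u) `^ (nu - 1) * stable_scaled alpha f t u * t `^ (c - 1))%:E.
have mK : measurable_fun [set: R * R] (fun z => K z.1 z.2).
  rewrite /K /stable_scaled; mfun.
  by apply: measurableT_comp => //; mfun.
have K0 t u : P t -> (`]0, x[%classic : set R) u -> (0 <= K t u)%E.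
  rewrite in_pos /= in_itv/= => t0 /andP[u0 _].
  rewrite lee_fin; apply: mulr_ge0; last exact: powR_ge0.
  by apply: mulr_ge0; [exact: powR_ge0|exact: scaled_ge0].
transitivity (((Gamma nu)^-1)%:E * \int[mu]_(t in P) \int[mu]_(u in `]0%R, x[) K t u)%E.
  rewrite -ge0_integralZl//; last 3 first.
  - exact: (measurable_integral_on _ _ _ measurable_pos (measurable_itv _) mK K0).
  - by move=> t Pt; apply: integral_ge0 => u ux; exact: K0.
  - by rewrite lee_fin invr_ge0 ltW// Gamma_gt0.
  apply: eq_integral => t; rewrite inE in_pos => t0.
  rewrite RL_int_open//; last exact: measurable_stable_scaled.
  rewrite -muleA; congr (_ * _)%E; rewrite -ge0_integralZr//.
  - by apply: measurable_funTS; have ms := measurable_stable_scaled t; mfun.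
  - by move=> u; rewrite /= in_itv/= => /(k0 t u t0).
  - by rewrite lee_fin powR_ge0.
rewrite tonelli_on//.
transitivity (((Gamma nu)^-1 * (Gamma c / Gamma (alpha * c)))%:E *
   \int[mu]_(u in `]0%R, x[) (u `^ (alpha * c - 1) * (x - u) `^ (nu - 1))%:E)%E.
  rewrite EFinM -muleA; congr (_ * _)%E; rewrite -ge0_integralZl//; last 3 first.
  - by mfun.
  - by move=> u _; rewrite lee_fin mulr_ge0 ?powR_ge0.
  - by rewrite lee_fin ltW// divr_gt0 ?Gamma_gt0.
  apply: eq_integral => u; rewrite inE/= in_itv/= => /andP[u0 ux].
  rewrite -EFinM mulrA [RHS]EFinM [X in (X%:E * _)%E]mulrC -M0// muleC -ge0_integralZl//; last 3 first.
  - apply: measurable_funTS; rewrite /stable_scaled; mfun.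
    by apply: measurableT_comp => //; mfun.
  - by move=> t; rewrite in_pos => t0; rewrite lee_fin mulr_ge0 ?powR_ge0 ?scaled_ge0.
  - by rewrite lee_fin powR_ge0.
  by apply: eq_integral => t _; rewrite /K -[RHS]EFinM [in RHS]mulrA.
rewrite integral_beta// -EFinM [nu + _]addrC; congr EFin.
have h1 := lt0r_neq0 (Gamma_gt0 _ nu_gt0).
have h2 := lt0r_neq0 (Gamma_gt0 _ ac0).
have h3 := lt0r_neq0 (Gamma_gt0 _ (addr_gt0 ac0 nu_gt0)).
move: (Gamma nu) (Gamma c) (Gamma (alpha * c)) (Gamma (alpha * c + nu)) h1 h2 h3.
move=> A B C D h1 h2 h3.
by field; rewrite h1 h2 h3.
Qed.

(** With r = t^(-1/alpha), rescaling the variable by r multiplies the kernel (x-u)^(nu-1) by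
    r^(nu-1), hence the factor r^(1-nu). This links the first two integral representations. *)
Lemma RL_int_scaledE (nu x t : R) : 0 <= nu -> 0 < x -> 0 < t ->
  RL_int nu (stable_scaled alpha f t) x =
  (RL_int nu f (x * t `^ (- alpha^-1))%R * (t `^ ((nu - 1) / alpha))%:E)%E.
Proof.
move=> nu_ge0 x0 t0; set r := t `^ (- alpha^-1).
have r0 : 0 < r by rewrite powR_gt0.
have rE : t `^ ((nu - 1) / alpha) = r `^ (1 - nu).
  by rewrite /r -powRrM; congr (_ `^ _); field; rewrite gt_eqF.
rewrite {}rE; have [->|nu0] := eqVneq nu 0.
  by rewrite /RL_int eqxx subr0 powRr1 ?ltW// -EFinM.
have nu_gt0 : 0 < nu by rewrite lt0r nu0.
rewrite !RL_int_open//; last exact: measurable_stable_scaled.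
rewrite (ge0_integral_scale_itv _ (x * r) r)//; last 2 first.
- by mfun.
- by move=> u /andP[u0 _]; rewrite mulr_ge0 ?powR_ge0 ?f0.
rewrite mulfK ?gt_eqF// -muleA; congr (_ * _)%E; rewrite -ge0_integralZr//; last 3 first.
- apply: measurable_funTS; mfun.
  by apply: measurableT_comp => //; mfun.
- move=> u; rewrite /= in_itv/= => /andP[u0 _].
  by rewrite lee_fin !mulr_ge0 ?powR_ge0 ?f0 ?mulr_gt0// ltW.
- by rewrite lee_fin powR_ge0.
apply: eq_integral => u; rewrite inE/= in_itv/= => /andP[u0 ux].
rewrite /stable_scaled -/r -EFinM; congr EFin.
rewrite (_ : x * r - r * u = r * (x - u)); last by ring.
rewrite powRM ?subr_ge0 ?(ltW r0) ?(ltW ux)// [u * r]mulrC.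
have E1 : r `^ (nu - 1) * r `^ (1 - nu) = 1.
  by rewrite -gt0_powRD// (_ : _ + _ = 0) ?powRr0//; ring.
rewrite [RHS](_ : _ = (r `^ (nu - 1) * r `^ (1 - nu)) * ((x - u) `^ (nu - 1) * (f (r * u) * r))); last by ring.
by rewrite E1 mul1r.
Qed.

End stable.

(** * From moments to the Prabhakar function *)

Section prabhakar_mixture.
Context {R : realType}.
Local Notation mu := (@lebesgue_measure R).
Local Notation P := (`]0%R, +oo[%classic : set R).

(** The common criterion for all kernels. For alpha < 1 it is used with y = x^alpha and [C] equal to
    x^(b-1), or alpha x^(b-2) for the last identity; for alpha = 1 with y = x and C = Gamma(nu)
    x^(b-1). *)
Lemma prabhakar_mixture (G : R -> \bar R) (delta alpha b l y C : R) :
  0 < delta -> 0 < alpha -> 0 < b -> 0 <= l -> 0 <= y ->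
  measurable_fun P G -> (forall t : R, 0 < t -> (0 <= G t)%E) ->
  (forall k : nat, (\int[mu]_(t in P) (G t * (t ^+ k)%:E) =
    (C * y ^+ k * (Gamma (delta + k%:R) / Gamma (alpha * k%:R + b)))%:E)%E) ->
  (\int[mu]_(t in P) (G t * (expR (- (l * t)))%:E) =
   (C * Gamma delta * prabhakar delta alpha b (- (l * y)))%:E)%E.
Proof.
move=> d0 a0 b0 l0 y0 mG G0 Gq.
pose coef := prabhakar_coef delta alpha b.
have qE c k : c ^+ k / k`!%:R * (C * y ^+ k * (Gamma (delta + k%:R) / Gamma (alpha * k%:R + b))) =
    C * (coef k * (c * y) ^+ k).
  by rewrite /coef /prabhakar_coef exprMn invfM; ring.
have seriesE c : series (fun k => c ^+ k / k`!%:R *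
      (C * y ^+ k * (Gamma (delta + k%:R) / Gamma (alpha * k%:R + b)))) =
    (fun n => C * series (fun k => coef k * (c * y) ^+ k) n).
  apply/funext => n; rewrite !seriesEnat/= mulr_sumr.
  by apply: eq_bigr => k _; exact: qE.
have cvgp z : cvgn (series (fun k => coef k * z ^+ k)).
  apply: normed_cvg.
  rewrite [X in cvgn X](_ : _ = series (fun k => coef k * `|z| ^+ k)).
    exact: cvg_prabhakar_series.
  congr series; apply/funext => k /=.
  by rewrite normrM normrX ger0_norm// ltW// prabhakar_coef_gt0.
have limC (c : R) (u : nat -> R) : cvgn u -> limn (fun n => c * u n) = c * limn u.
  by move=> cu; apply/cvg_lim => //; exact: cvgMr.
rewrite (moments_expansion _ G l mG G0 Gq l0); last first.
  by rewrite seriesE; apply: is_cvgMr; exact: cvgp.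
congr EFin; rewrite seriesE mulNr.
have -> : prabhakar delta alpha b (- (l * y)) =
    (Gamma delta)^-1 * limn (series (fun k => coef k * (- (l * y)) ^+ k)).
  rewrite /prabhakar -limC; last exact: cvgp.
  congr (limn _); apply/funext => n; rewrite seriesEnat/= big_mkord mulr_sumr.
  by apply: eq_bigr => k _; rewrite mulrA.
by rewrite limC ?mulrA ?mulfK ?gt_eqF ?Gamma_gt0//; exact: cvgp.
Qed.

End prabhakar_mixture.

(** * The case alpha < 1 *)

Section case_lt1.
Context {R : realType}.
Local Notation mu := (@lebesgue_measure R).
Local Notation P := (`]0%R, +oo[%classic : set R).
Variables (alpha : R) (f : R -> R).
Hypotheses (a0 : 0 < alpha) (a1 : alpha < 1) (df : stable_density alpha f).
Variables (nu delta l x : R).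
Hypotheses (nu0 : 0 <= nu) (d0 : 0 < delta) (l0 : 0 <= l) (x0 : 0 < x).
(** This is beta + theta in the original parameters. *)
Let b := nu + alpha * delta.

Let b0 : 0 < b. Proof. by rewrite /b ltr_wpDl// mulr_gt0. Qed.
Let dk0 k : 0 < delta + k%:R. Proof. by rewrite ltr_wpDr. Qed.

Let powR_split (c : R) k : x `^ (c + alpha * k%:R) = x `^ c * (x `^ alpha) ^+ k.
Proof. by rewrite gt0_powRD// powRrM powR_mulrn ?powR_ge0. Qed.

Let powR_exp (t c : R) k : 0 < t -> t `^ (c + k%:R) = t `^ c * t ^+ k.
Proof. by move=> t0; rewrite gt0_powRD// powR_mulrn ?ltW. Qed.

Lemma prabhakar_RL_int_scaled :
  (\int[mu]_(t in P) (RL_int nu (stable_scaled alpha f t) x *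
      (t `^ (delta - 1) * expR (- (l * t)))%:E) =
   (x `^ (b - 1) * Gamma delta * prabhakar delta alpha b (- (l * x `^ alpha)))%:E)%E.
Proof.
rewrite -(prabhakar_mixture (fun t => RL_int nu (stable_scaled alpha f t) x * (t `^ (delta - 1))%:E)%E)//.
- by apply: eq_integral => t _; rewrite EFinM muleA.
- exact: powR_ge0.
- apply: emeasurable_funM; first exact: (measurable_RL_int_scaled _ _ df).
  by apply: measurable_funTS; mfun.
- move=> t t0; apply: mule_ge0; last by rewrite lee_fin powR_ge0.
  exact: (RL_int_scaled_ge0 _ _ df).
- move=> k; rewrite -powR_split.
  transitivity (\int[mu]_(t in P) (RL_int nu (stable_scaled alpha f t) x * (t `^ (delta + k%:R - 1))%:E))%E.
    apply: eq_integral => t; rewrite inE in_pos => t0; rewrite -muleA -EFinM addrAC.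
    by rewrite powR_exp.
  rewrite (RL_int_scaled_moment _ _ a0 a1 df nu x (delta + k%:R) nu0 x0 (dk0 k)); congr (_ `^ _ * (_ / Gamma _))%:E; rewrite /b; ring.
Qed.

Lemma prabhakar_RL_int_dilated :
  (\int[mu]_(t in P) (RL_int nu f (x * t `^ (- alpha^-1)) *
      (t `^ ((b - 1) / alpha - 1) * expR (- (l * t)))%:E) =
   (x `^ (b - 1) * Gamma delta * prabhakar delta alpha b (- (l * x `^ alpha)))%:E)%E.
Proof.
rewrite -prabhakar_RL_int_scaled; apply: eq_integral => t; rewrite inE in_pos => t0.
rewrite (RL_int_scaledE _ _ a0 df)// -muleA -EFinM mulrA -gt0_powRD//.
congr (_ * (_ `^ _ * _)%:E)%E; rewrite /b; field; exact: lt0r_neq0.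
Qed.

(** For c = delta + k - 1 and nu = 1 - alpha, the stable moment quotient Gamma(1+c) / Gamma(1 +
    alpha c) is already Gamma(delta+k) / Gamma(alpha k + b). Here c > -1 is all that is
    available. *)
Lemma prabhakar_stable_x : nu = 1 - alpha ->
  (\int[mu]_(t in P) (f (x * t `^ (- alpha^-1)) *
      (t `^ ((b - 2) / alpha - 1) * expR (- (l * t))))%:E =
   (alpha * x `^ (b - 2) * Gamma delta * prabhakar delta alpha b (- (l * x `^ alpha)))%:E)%E.
Proof.
move=> nuE; have [mf f0 _ _] := df.
rewrite -(prabhakar_mixture (fun t => (f (x * t `^ (- alpha^-1)) * t `^ ((b - 2) / alpha - 1))%:E)%E)//.
- by apply: eq_integral => t _; rewrite -EFinM mulrA.
- exact: powR_ge0.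
- apply: measurable_funTS; mfun.
  by apply: measurableT_comp => //; mfun.
- move=> t t0; rewrite lee_fin mulr_ge0 ?powR_ge0// f0// mulr_ge0 ?powR_ge0// ltW//.
- move=> k; rewrite -[alpha * _ * _]mulrA -powR_split.
  transitivity (\int[mu]_(t in P) (f (x * t `^ (- alpha^-1)) *
      t `^ (delta + k%:R - 1 - alpha^-1 - 1))%:E)%E.
    apply: eq_integral => t; rewrite inE in_pos => t0; rewrite -EFinM -mulrA -powR_exp//.
    congr (_ * _ `^ _)%:E; rewrite /b nuE; field; exact: lt0r_neq0.
  have c1 : -1 < delta + k%:R - 1 by rewrite ltrDr.
  rewrite (stable_mixture_moment _ _ a0 a1 df _ x c1 x0).
  congr (_ * _ `^ _ * (Gamma _ / Gamma _))%:E; rewrite /b ?nuE; ring.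
Qed.

End case_lt1.

(** * The case alpha = 1 *)

Section case_eq1.
Context {R : realType}.
Local Notation mu := (@lebesgue_measure R).
Local Notation P := (`]0%R, +oo[%classic : set R).
Local Notation dirac_at t := (@dirac _ (measurableTypeR R) t%R R).
Variables (nu delta l : R).
Hypotheses (nu_ge0 : 0 <= nu) (d0 : 0 < delta) (l0 : 0 <= l).
Let b := nu + delta.
Let h (x : R) := x `^ (b - 1) * prabhakar delta 1 b (- (l * x)).

Let b0 : 0 < b. Proof. by rewrite /b ltr_wpDl. Qed.

(** Up to 1 / Gamma(nu) this is the fractional integral of t^(delta-1) exp(-l t) at [x]; the moments
    of its kernel are beta integrals. *)
Lemma prabhakar_convolution (x : R) : 0 < nu -> 0 < x ->
  (\int[mu]_(t in `]0%R, x[) ((x - t) `^ (nu - 1) * (t `^ (delta - 1) * expR (- (l * t))))%:E =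
   (Gamma nu * Gamma delta * h x)%:E)%E.
Proof.
move=> nu0 x0.
pose I := (`]0, x[%classic : set R).
pose G t := (\1_I t * ((x - t) `^ (nu - 1) * t `^ (delta - 1)))%:E.
have mG : measurable_fun P G by apply: measurable_funTS; rewrite /G; mfun.
have G0 (t : R) : 0 < t -> (0 <= G t)%E.
  by move=> t0; rewrite lee_fin mulr_ge0 ?indicE// mulr_ge0 ?powR_ge0.
have dk0 k : 0 < delta + k%:R by rewrite ltr_wpDr.
have Gk k : (\int[mu]_(t in P) (G t * (t ^+ k)%:E) =
    (Gamma nu * x `^ (b - 1) * x ^+ k * (Gamma (delta + k%:R) / Gamma (1 * k%:R + b)))%:E)%E.
  transitivity (\int[mu]_(t in I) (t `^ (delta + k%:R - 1) * (x - t) `^ (nu - 1))%:E)%E.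
    rewrite /I itv0E -(integral_indicM P _ (fun t => t `^ (delta + k%:R - 1) * (x - t) `^ (nu - 1))).
    apply: eq_integral => t; rewrite inE in_pos => t0; rewrite -EFinM; congr EFin.
    by rewrite addrAC (gt0_powRD _ (delta - 1))// powR_mulrn ?(ltW t0)//; ring.
  rewrite integral_beta//; congr EFin.
  rewrite (_ : delta + k%:R + nu = 1 * k%:R + b); last by rewrite /b; ring.
  rewrite (_ : 1 * k%:R + b - 1 = (b - 1) + k%:R); last by ring.
  by rewrite (gt0_powRD _ (b - 1))// powR_mulrn ?(ltW x0)//; ring.
have := prabhakar_mixture G delta 1 b l x _ d0 ltr01 b0 l0 (ltW x0) mG G0 Gk.
rewrite /h itv0E -(integral_indicM P _ (fun t => (x - t) `^ (nu - 1) * (t `^ (delta - 1) * expR (- (l * t))))).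
move=> E; rewrite (_ : _ * _ * (_ * _) = Gamma nu * x `^ (b - 1) * Gamma delta * prabhakar delta 1 b (- (l * x))); last by ring.
by rewrite -E; apply: eq_integral => t _; rewrite /G -EFinM !mulrA.
Qed.

(** The gamma factors cancel and leave the exponential series. It settles nu = 0, where no
    fractional integral remains. *)
Lemma prabhakar_exp (z : R) : prabhakar delta 1 delta z = (Gamma delta)^-1 * expR z.
Proof.
rewrite /prabhakar; apply/cvg_lim => //.
rewrite (_ : (fun n => _) = fun n => (Gamma delta)^-1 * series (exp_coeff z) n).
  by apply: cvgMr; exact: is_cvg_series_exp_coeff.
apply/funext => n; rewrite seriesEnat/= big_mkord mulr_sumr; apply: eq_bigr => k _.
rewrite -mulrA; congr (_ * _); rewrite /exp_coeff/= mul1r [k%:R + _]addrC.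
have g1 : Gamma (delta + k%:R) != 0 by rewrite lt0r_neq0// Gamma_gt0// ltr_wpDr.
by rewrite invfM [X in X * _]mulrCA mulfV// mulr1 mulrC.
Qed.

Let RL_meas0_dirac (t : R) (A : set R) : nu = 0 ->
  RL_meas nu (dirac_at t) A = (\1_A t)%:E.
Proof. by move=> nu0; rewrite /RL_meas nu0 eqxx. Qed.

(** The density of the fractional integral of the unit mass at [t]. The condition t <= x is an
    indicator in x - t, which makes [k] jointly measurable, as Tonelli requires. *)
Let k (t x : R) := \1_(`[0, +oo[%classic : set R) (x - t) * ((Gamma nu)^-1 * (x - t) `^ (nu - 1)).

Let k_ge0 (t x : R) : 0 < nu -> 0 <= k t x.
Proof.
move=> nu0; rewrite /k; apply: mulr_ge0; first by rewrite indicE.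
by apply: mulr_ge0; [rewrite invr_ge0 ltW// Gamma_gt0|exact: powR_ge0].
Qed.

Let RL_meas_dirac (t : R) (A : set R) : nu != 0 -> 0 < t ->
  RL_meas nu (dirac_at t) A = (\int[mu]_(x in A) (k t x)%:E)%E.
Proof.
move=> nu0 t0; rewrite /RL_meas (negbTE nu0); apply: eq_integral => x _.
rewrite integral_dirac//; last by apply: measurable_funTS; mfun.
rewrite diracE -!EFinM; congr EFin; rewrite /k indicE mulrCA; congr ((nat_of_bool _)%:R * _).
by apply/idP/idP; rewrite !inE/= !in_itv/= ?andbT (ltW t0) subr_ge0.
Qed.

Section measurable_set.
Variable (A : set R).
Hypotheses (mA : measurable A) (AP : A `<=` P).

(** For nu > 0, Tonelli puts the integral over [A] outside, and the inner integral at fixed [x] is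
    the convolution above. *)
Lemma prabhakar_RL_meas :
  (\int[mu]_(x in A) (h x)%:E = ((Gamma delta)^-1)%:E *
    \int[mu]_(t in P) (RL_meas nu (dirac_at t) A * (t `^ (delta - 1) * expR (- (l * t)))%:E))%E.
Proof.
have gd0 : 0 < Gamma delta by exact: Gamma_gt0.
have [nu0|nu0] := eqVneq nu 0.
  under [in RHS]eq_integral do rewrite RL_meas0_dirac// -EFinM.
  rewrite integral_indicM (setIidr AP) -ge0_integralZl//; last 3 first.
  - by apply: measurable_funTS; mfun.
  - by move=> t _; rewrite lee_fin mulr_ge0 ?powR_ge0 ?expR_ge0.
  - by rewrite lee_fin invr_ge0 ltW.
  apply: eq_integral => t _; rewrite -EFinM /h /b nu0 add0r prabhakar_exp.
  by congr EFin; ring.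
have nu_gt0 : 0 < nu by rewrite lt0r nu0.
have gn0 : 0 < Gamma nu by exact: Gamma_gt0.
pose K t x := (k t x * (t `^ (delta - 1) * expR (- (l * t))))%:E.
have mK : measurable_fun [set: R * R] (fun z => K z.1 z.2) by rewrite /K /k; mfun.
have K0 t x : (0 <= K t x)%E.
  by rewrite lee_fin; apply: mulr_ge0; [exact: k_ge0|rewrite mulr_ge0 ?powR_ge0 ?expR_ge0].
transitivity (((Gamma delta)^-1)%:E * \int[mu]_(t in P) \int[mu]_(x in A) K t x)%E; last first.
  congr (_ * _)%E; apply: eq_integral => t; rewrite inE in_pos => t0.
  rewrite RL_meas_dirac// -ge0_integralZr//.
  - by apply: measurable_funTS; rewrite /k; mfun.
  - by move=> x _; rewrite lee_fin; exact: k_ge0.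
  - by rewrite lee_fin mulr_ge0 ?powR_ge0 ?expR_ge0.
rewrite tonelli_on//.
rewrite -ge0_integralZl//; last 3 first.
- have mK' : measurable_fun [set: R * R] (fun z => K z.2 z.1) by rewrite /K /k; mfun.
  exact: (measurable_integral_on _ _ (fun x t => K t x) mA measurable_pos mK' (fun x t _ _ => K0 t x)).
- by move=> x _; apply: integral_ge0 => t _; exact: K0.
- by rewrite lee_fin invr_ge0 ltW.
apply: eq_integral => x; rewrite inE => /AP; rewrite in_pos => x0.
have -> : (\int[mu]_(t in P) K t x = (Gamma delta * h x)%:E)%E.
  transitivity (((Gamma nu)^-1)%:E * \int[mu]_(t in `]0%R, x[) ((x - t) `^ (nu - 1) * (t `^ (delta - 1) * expR (- (l * t))))%:E)%E; last first.
    rewrite prabhakar_convolution// -EFinM; congr EFin.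
    by rewrite -[Gamma nu * _ * _]mulrA mulKf// gt_eqF.
  (* The density [k] allows t = x while the convolution is over t < x; the point is null. *)
  rewrite integral_itv_bndo_bndc; last by mfun.
  rewrite (_ : `]0, x]%classic = P `&` `]-oo, x]%classic); last first.
    by apply/seteqP; split => t /=; rewrite !in_itv/= andbT; [move=> /andP[-> ->]|case=> -> ->].
  rewrite -(integral_indicM P _ (fun t => (x - t) `^ (nu - 1) * (t `^ (delta - 1) * expR (- (l * t))))).
  rewrite -ge0_integralZl//; last 3 first.
  - by apply: measurable_funTS; mfun.
  - by move=> t _; rewrite lee_fin mulr_ge0 ?mulr_ge0 ?powR_ge0 ?expR_ge0// ?indicE.
  - by rewrite lee_fin invr_ge0 ltW.
  apply: eq_integral => t _; rewrite /K /k -EFinM; congr EFin.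
  rewrite !indicE (_ : (x - t \in (`[0, +oo[%classic : set R)) = (t \in (`]-oo, x]%classic : set R))); first by ring.
  by apply/idP/idP; rewrite !inE/= !in_itv/= andbT subr_ge0.
by rewrite -EFinM mulKf// gt_eqF.
Qed.

(** The set occurring in [dilate] for s = 1/t, that is, [A] divided by [t]. *)
Let B (t : R) := [set y : R | A (y / t^-1)].

Let indicB (t : R) : \1_(B t) = (fun y => \1_A (y * t)) :> (R -> R).
Proof.
apply/funext => y; rewrite !indicE; congr (nat_of_bool _)%:R.
by apply/idP/idP; rewrite !inE /B/= invrK.
Qed.

Let mB (t : R) : measurable (B t).
Proof. by apply/(@measurable_indicP _ _ R); rewrite indicB; mfun. Qed.

(** The rule delta(x/t - 1) = t delta(x - t). *)
Lemma dilate_dirac1 (t : R) : dilate (dirac_at 1) t^-1 A = (\1_A t * t)%:E.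
Proof.
transitivity ((t^-1)^-1%:E * (\1_(B t) (1 : R))%:E)%E; first by [].
by rewrite indicB mul1r invrK muleC.
Qed.

(** The factor x of the dilated measure is evaluated at its atom x = t and contributes the second
    [t]. *)
Lemma dilate_x_dirac1 (t : R) : dilate_x (dirac_at 1) t^-1 A = (\1_A t * (t * t))%:E.
Proof.
rewrite /dilate_x -/(B t) integral_dirac; last 2 first.
- exact: mB.
- by apply: measurable_funTS; mfun.
rewrite [dirac _ _](_ : _ = (\1_A t)%:E); last first.
  by transitivity ((\1_(B t) (1 : R))%:E : \bar R) => //; rewrite indicB mul1r.
by rewrite invrK mul1r -!EFinM mulrCA.
Qed.

(** The counterpart of [RL_int_scaledE] for alpha = 1: the density is homogeneous, k 1 (x/t) =
    t^(1-nu) k t x, and the Jacobian 1/t cancels the normalisation of [dilate]. *)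
Lemma dilate_RL_meas (t : R) : 0 < t ->
  dilate (RL_meas nu (dirac_at 1)) t^-1 A =
  (RL_meas nu (dirac_at t) A * (t `^ (1 - nu))%:E)%E.
Proof.
move=> t0; rewrite /dilate -/(B t) invrK.
have [nu0|nu0] := eqVneq nu 0.
  by rewrite !RL_meas0_dirac// indicB mul1r nu0 subr0 powRr1 ?ltW// muleC.
have nu_gt0 : 0 < nu by rewrite lt0r nu0.
rewrite !RL_meas_dirac//.
have BP : B t `<=` P.
  by move=> y /AP; rewrite !in_pos invrK pmulr_lgt0.
have kE x : k 1 (t^-1 * x) * t^-1 = k t x * (t `^ (1 - nu) * t^-1).
  rewrite (_ : k t x = \1_(`[0, +oo[%classic : set R) (t^-1 * x - 1) * ((Gamma nu)^-1 * (x - t) `^ (nu - 1))); last first.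
    rewrite /k !indicE; congr ((nat_of_bool _)%:R * _).
    by apply/idP/idP; rewrite !inE/= !in_itv/= !andbT !subr_ge0 ler_pdivlMl// mulr1.
  rewrite /k indicE; have [|_] := boolP (_ \in _); last by rewrite !mul0r.
  rewrite inE/= in_itv/= andbT subr_ge0 ler_pdivlMl// mulr1 => tx.
  rewrite (_ : t^-1 * x - 1 = t^-1 * (x - t)); last first.
    by rewrite mulrBr mulVf// gt_eqF.
  rewrite powRM ?invr_ge0 ?subr_ge0 ?(ltW t0)//.
  have -> : t^-1 `^ (nu - 1) = t `^ (1 - nu).
    by rewrite -(powR_inv1 (ltW t0)) -powRrM mulN1r opprB.
  by ring.
rewrite -(setIidr BP) -(integral_indicM P) -(ge0_integral_scale _ t^-1)//; last 3 first.
- by rewrite invr_gt0.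
- by apply: measurable_funTS; rewrite /k; mfun.
- by move=> y _; rewrite lee_fin; apply: mulr_ge0; [rewrite indicE|exact: k_ge0].
transitivity (t%:E * \int[mu]_(x in P) (\1_A x * (k t x * (t `^ (1 - nu) * t^-1)))%:E)%E.
  congr (_ * _)%E; apply: eq_integral => x _; rewrite -EFinM -kE mulrA; congr (_ * _ * _)%:E.
  by rewrite indicB mulrAC mulVf ?mul1r// gt_eqF.
rewrite integral_indicM (setIidr AP) -ge0_integralZl//; last 3 first.
- by apply: measurable_funTS; rewrite /k; mfun.
- move=> x _; rewrite lee_fin; apply: mulr_ge0; first exact: k_ge0.
  by rewrite mulr_ge0 ?powR_ge0// invr_ge0 ltW.
- by rewrite lee_fin ltW.
rewrite -ge0_integralZr//; last 3 first.
- by apply: measurable_funTS; rewrite /k; mfun.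
- by move=> x _; rewrite lee_fin; exact: k_ge0.
- by rewrite lee_fin powR_ge0.
apply: eq_integral => x _; rewrite -!EFinM; congr EFin.
by rewrite mulrCA [t * _]mulrCA divff ?mulr1// gt_eqF.
Qed.

Lemma prabhakar_dilate_RL_meas :
  (\int[mu]_(x in A) (h x)%:E = ((Gamma delta)^-1)%:E *
    \int[mu]_(t in P) (dilate (RL_meas nu (dirac_at 1)) t^-1 A *
      (t `^ (b - 1 - 1) * expR (- (l * t)))%:E))%E.
Proof.
rewrite prabhakar_RL_meas; congr (_ * _)%E; apply: eq_integral => t.
rewrite inE in_pos => t0; rewrite dilate_RL_meas// -muleA -EFinM mulrA -gt0_powRD//.
by congr (_ * (_ `^ _ * _)%:E)%E; rewrite /b; ring.
Qed.

Lemma prabhakar_dirac : nu = 0 ->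
  (\int[mu]_(x in A) (h x)%:E = ((Gamma delta)^-1)%:E *
    \int[mu]_(t in P) (\1_A t * (t `^ (b - 1) * expR (- (l * t))))%:E)%E.
Proof.
move=> nu0; rewrite prabhakar_RL_meas /b nu0 add0r; congr (_ * _)%E.
by apply: eq_integral => t _; rewrite -nu0 RL_meas0_dirac.
Qed.

End measurable_set.

End case_eq1.

(** * Return to the original parameters *)

Theorem theorem1 (R : realType) (alpha gamma beta theta lambda : R)
  (ha0 : 0 < alpha) (ha1 : alpha <= 1) (hg : 0 < gamma)
  (hb : alpha * gamma <= beta) (ht : - (alpha * gamma) < theta)
  (hl : 0 <= lambda) :
  (* case 0 < alpha < 1: pointwise identities, for every x > 0 *)
  (alpha < 1 -> forall f : R -> R, stable_density alpha f ->
   forall x : R, 0 < x ->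
   [/\ (x `^ (beta + theta - 1)
          * prabhakar (gamma + theta / alpha) alpha (beta + theta) (- (lambda * x `^ alpha)))%:E
       = (((Gamma (gamma + theta / alpha))^-1)%:E
          * \int[@lebesgue_measure R]_(t in `]0%R, +oo[)
              (RL_int (beta - alpha * gamma) (stable_scaled alpha f t) x
               * (t `^ (gamma + theta / alpha - 1) * expR (- (lambda * t)))%:E))%E,
       (x `^ (beta + theta - 1)
          * prabhakar (gamma + theta / alpha) alpha (beta + theta) (- (lambda * x `^ alpha)))%:E
       = (((Gamma (gamma + theta / alpha))^-1)%:E
          * \int[@lebesgue_measure R]_(t in `]0%R, +oo[)
              (RL_int (beta - alpha * gamma) f (x * t `^ (- alpha^-1))
               * (t `^ ((beta + theta - 1) / alpha - 1) * expR (- (lambda * t)))%:E))%E,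
       (beta - alpha * gamma = 0 ->
        (x `^ (beta + theta - 1)
          * prabhakar (gamma + theta / alpha) alpha (beta + theta) (- (lambda * x `^ alpha)))%:E
        = (((Gamma (gamma + theta / alpha))^-1)%:E
           * \int[@lebesgue_measure R]_(t in `]0%R, +oo[)
               (f (x * t `^ (- alpha^-1))
                * (t `^ ((beta + theta - 1) / alpha - 1) * expR (- (lambda * t))))%:E)%E) &
       (beta - alpha * gamma = 1 - alpha ->
        (x `^ (beta + theta - 1)
          * prabhakar (gamma + theta / alpha) alpha (beta + theta) (- (lambda * x `^ alpha)))%:E
        = (((Gamma (gamma + theta / alpha))^-1)%:E * (x / alpha)%:E
           * \int[@lebesgue_measure R]_(t in `]0%R, +oo[)
               (f (x * t `^ (- alpha^-1))
                * (t `^ ((beta + theta - 2) / alpha - 1) * expR (- (lambda * t))))%:E)%E)])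
  /\
  (* case alpha = 1: f_1(. | t) = dirac t, identities in the sense of measures on (0,oo) *)
  (alpha = 1 -> forall A : set R, measurable A -> A `<=` `]0%R, +oo[ ->
   [/\ (\int[@lebesgue_measure R]_(x in A)
          (x `^ (beta + theta - 1)
            * prabhakar (gamma + theta / alpha) alpha (beta + theta) (- (lambda * x `^ alpha)))%:E)%E
       = (((Gamma (gamma + theta / alpha))^-1)%:E
          * \int[@lebesgue_measure R]_(t in `]0%R, +oo[)
              (RL_meas (beta - alpha * gamma) (@dirac _ (measurableTypeR R) t R) A
               * (t `^ (gamma + theta / alpha - 1) * expR (- (lambda * t)))%:E))%E,
       (\int[@lebesgue_measure R]_(x in A)
          (x `^ (beta + theta - 1)
            * prabhakar (gamma + theta / alpha) alpha (beta + theta) (- (lambda * x `^ alpha)))%:E)%E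
       = (((Gamma (gamma + theta / alpha))^-1)%:E
          * \int[@lebesgue_measure R]_(t in `]0%R, +oo[)
              (dilate (RL_meas (beta - alpha * gamma) (@dirac _ (measurableTypeR R) 1%R R)) (t `^ (- alpha^-1)) A
               * (t `^ ((beta + theta - 1) / alpha - 1) * expR (- (lambda * t)))%:E))%E,
       (beta - alpha * gamma = 0 ->
        (\int[@lebesgue_measure R]_(x in A)
          (x `^ (beta + theta - 1)
            * prabhakar (gamma + theta / alpha) alpha (beta + theta) (- (lambda * x `^ alpha)))%:E)%E
        = (((Gamma (gamma + theta / alpha))^-1)%:E
           * \int[@lebesgue_measure R]_(t in `]0%R, +oo[)
               (dilate (@dirac _ (measurableTypeR R) 1%R R) (t `^ (- alpha^-1)) A
                * (t `^ ((beta + theta - 1) / alpha - 1) * expR (- (lambda * t)))%:E))%E) &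
       (beta - alpha * gamma = 1 - alpha ->
        (\int[@lebesgue_measure R]_(x in A)
          (x `^ (beta + theta - 1)
            * prabhakar (gamma + theta / alpha) alpha (beta + theta) (- (lambda * x `^ alpha)))%:E)%E
        = (((Gamma (gamma + theta / alpha))^-1)%:E * (alpha^-1)%:E
           * \int[@lebesgue_measure R]_(t in `]0%R, +oo[)
               (dilate_x (@dirac _ (measurableTypeR R) 1%R R) (t `^ (- alpha^-1)) A
                * (t `^ ((beta + theta - 2) / alpha - 1) * expR (- (lambda * t)))%:E))%E)]).
Proof.
pose nu := beta - alpha * gamma; pose delta := gamma + theta / alpha.
have an0 : alpha != 0 by rewrite lt0r_neq0.
have nu0 : 0 <= nu by rewrite subr_ge0.
have d0 : 0 < delta.
  rewrite /delta -(pmulr_rgt0 _ ha0) mulrDr mulrCA divff// mulr1.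
  by rewrite -ltrBlDl sub0r.
have bE : beta + theta = nu + alpha * delta by rewrite /nu /delta; field.
have gd0 : Gamma delta != 0 by rewrite lt0r_neq0// Gamma_gt0.
split=> [a1 f df x x0|a1 A mA AP].
  rewrite -/nu -/delta bE.
  have cancel (r s : R) : (r * s)%:E = (((Gamma delta)^-1)%:E * (r * Gamma delta * s)%:E)%E.
    by rewrite -EFinM; congr EFin; field.
  split.
  - by rewrite (prabhakar_RL_int_scaled _ _ ha0 a1 df)// cancel.
  - by rewrite (prabhakar_RL_int_dilated _ _ ha0 a1 df)// cancel.
  - move=> n0; rewrite cancel -(prabhakar_RL_int_dilated _ _ ha0 a1 df)//.
    congr (_ * _)%E; apply: eq_integral => t _.
    by rewrite /RL_int n0 eqxx EFinM.
  - move=> n1; rewrite (prabhakar_stable_x _ _ ha0 a1 df)// -!EFinM; congr EFin.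
    rewrite (_ : nu + alpha * delta - 1 = (nu + alpha * delta - 2) + 1); last by ring.
    rewrite gt0_powRD// powRr1 ?ltW//; field.
    by rewrite an0.
subst alpha.
rewrite -/nu -/delta bE invr1 !mulr1 !mul1r mule1.
have hE : (\int[@lebesgue_measure R]_(x in A)
    (x `^ (nu + delta - 1) * prabhakar delta 1 (nu + delta) (- (lambda * x `^ 1)))%:E =
  \int[@lebesgue_measure R]_(x in A)
    (x `^ (nu + delta - 1) * prabhakar delta 1 (nu + delta) (- (lambda * x)))%:E)%E.
  by apply: eq_integral => x; rewrite inE => /AP; rewrite in_pos => x0; rewrite powRr1 ?ltW.
have tV (t : R) : `]0%R, +oo[%classic t -> t `^ (-1) = t^-1.
  by rewrite in_pos => t0; rewrite powR_inv1 ?ltW.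
rewrite hE; split.
- exact: prabhakar_RL_meas.
- rewrite prabhakar_dilate_RL_meas//; congr (_ * _)%E; apply: eq_integral => t.
  by rewrite inE => /tV ->.
(* The dilated unit mass contributes a factor t, which raises the exponent b - 2 to b - 1. *)
- move=> n0; rewrite prabhakar_dirac//; congr (_ * _)%E; apply: eq_integral => t.
  rewrite inE => /[dup] /tV ->; rewrite in_pos => t0; rewrite dilate_dirac1 -EFinM -mulrA.
  congr (_ * _)%:E; rewrite mulrA; congr (_ * _).
  rewrite -{2}(powRr1 (ltW t0)) -gt0_powRD//; congr (_ `^ _); ring.
(* For alpha = 1 the condition nu = 1 - alpha is again nu = 0; now the factor is t^2 and the
   exponent b - 3. *)
- rewrite subrr => n0; rewrite prabhakar_dirac//; congr (_ * _)%E; apply: eq_integral => t.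
  rewrite inE => /[dup] /tV ->; rewrite in_pos => t0; rewrite dilate_x_dirac1// -EFinM -mulrA.
  congr (_ * _)%:E; rewrite mulrA; congr (_ * _).
  rewrite -{2 3}(powRr1 (ltW t0)) -!gt0_powRD//; congr (_ `^ _); ring.
Qed.
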